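(* Let $\epsilon\in\mathbb R$ and let $\chi$ be a one-dimensional irreducible representation of the dihedral group $G=I_2(m)$. For $k\in\mathbb Z_{\ge0}$ denote by $\sigma_{\chi,k}=\chi(\sigma(k))$ the scalar by which $\sigma(k)$ acts in $\chi$; let $\lambda_0:=\epsilon\sigma_{\chi,0}$ and, for $k\in\mathbb Z\setminus\{0\}$, $$\lambda_k:=\mathrm{sign}(k)\sqrt{(|k|-N_c(\chi))^2-(1-\epsilon^2)\sigma_{\chi,|k|}^2}.$$ Let $\mathcal H_c(\chi)_{\lambda_0}=\mathbb C_\chi$ be the representation space of $\chi$ and let $\mathcal H_c(\chi)_{\lambda}$ denote the $\lambda$-eigenspace of $Z_0+\epsilon\sigma$ in $\ker E_-$. Let $c$ be real-valued and close enough to $c=0$ such that $M_c(\chi)$ is irreducible and unitarisable. Then the joint $(\mathcal V,\mathfrak u(1,1))$-decomposition of $M_c(\chi)$ is $$M_c(\chi)=\bigoplus_{k\in\mathbb Z}\mathcal H_c(\chi)_{\lambda_k}\otimes L_{\mathfrak u(1,1)}(|k|+1-N_c(\chi),\lambda_k).$$ Each of the spaces $\mathcal H_c(\chi)_{\lambda_k}$ is a one-dimensional irreducible module for $\mathcal V$.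
   Context: Let $E=\mathbb R^2$ with standard Euclidean structure, orthonormal basis $\xi,\eta$ and dual basis $x,y$ of $E^*$; $z=x+iy$, $\bar z=x-iy$, $\zeta=\frac12(\xi-i\eta)$, $\bar\zeta=\frac12(\xi+i\eta)$. $G=I_2(m)$ is the dihedral group of order $2m$ generated by the reflections $s_1,\dots,s_m$, where $s_j$ is the reflection in the root $\alpha_j=\sin(\pi j/m)\xi-\cos(\pi j/m)\eta$; put $a_j=\sin(\pi j/m)x-\cos(\pi j/m)y$. $c$ is a conjugation-invariant function on the reflections. $H_c(G,E)$ is the rational Cherednik algebra, the quotient of $T(E_{\mathbb C}\oplus E_{\mathbb C}^* )\rtimes G$ (where $gX=(g\cdot X)g$) by the relations that elements of $E$ commute, elements of $E^*$ commute, and $[\xi',x']=\langle x',\xi'\rangle-2\sum_{j=1}^mc(s_j)\langle x',\alpha_j\rangle\langle a_j,\xi'\rangle s_j$ for $\xi'\in E$, $x'\in E^*$, with $\langle\cdot,\cdot\rangle$ the natural pairing of $E^*$ and $E$. With $\omega=\exp(2\pi i/m)$, put $\sigma(k)=\sum_{j=1}^mc(s_j)\omega^{kj}s_j$ and $\sigma=\sigma(0)$. Put $E_+=\frac12z\bar z$, $E_-=-2\zeta\bar\zeta$, $H=z\zeta+\bar z\bar\zeta+1-\sigma$, $Z_0=\bar z\bar\zeta-z\zeta$. Here $\mathfrak u(1,1)\subset H_c(G,E)$ is the Lie algebra generated by $E_\pm,H$ and the central element $Z_0+\epsilon\sigma$, and $\mathcal V$ is its centraliser in $H_c(G,E)$.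 $L_{\mathfrak u(1,1)}(\mu,\nu)$ is the irreducible lowest weight $\mathfrak u(1,1)$-representation with lowest weight vector (annihilated by $E_-$) on which $H$ acts by $\mu$ and the central element $Z_0+\epsilon\sigma$ by $\nu$. $M_c(\chi)\cong\mathbb C[E]\otimes\mathbb C_\chi$ is the standard module of $H_c(G,E)$, induced from $\mathbb C_\chi$ with $E$ acting by zero on $\mathbb C_\chi$; $\ker E_-$ denotes the kernel of $E_-$ acting on $M_c(\chi)$. $N_c(\chi)=\chi(\sigma(0))$. For real-valued $c$, $\ast$ is the conjugate-linear anti-involution of $H_c(G,E)$ with $\xi^*=x$, $x^*=\xi$, $\eta^*=y$, $y^*=\eta$, $s_j^*=s_j$; $M_c(\chi)$ is unitarisable if its Hermitian form $\beta$ with $\beta(hp,q)=\beta(p,h^*q)$, restricting to a $G$-invariant inner product on $\mathbb C_\chi$, is positive definite. *)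

(* Defs.v *)
From HB Require Import structures.
From mathcomp Require Import all_boot all_order all_algebra.
From mathcomp Require Import complex.
From mathcomp Require Import all_classical all_reals all_analysis.

Set Implicit Arguments.
Unset Strict Implicit.
Unset Printing Implicit Defensive.

Import Order.TTheory GRing.Theory Num.Theory.

Local Open Scope classical_set_scope.
Local Open Scope complex_scope.
Local Open Scope ring_scope.
Local Open Scope quotient_scope.

(* The unital associative K-algebra with generators X and relations r: formal
   expressions modulo the least congruence that contains r and the axioms of a
   K-algebra. It is a pzRingType with an lmodType K structure rather than an
   algType K, because the zero algebra can also be presented in this way. *)

Inductive expr (K X : Type) : Type :=
| Gen of X
| Cst of K
| Add of expr K X & expr K X
| Mul of expr K X & expr K X.

Arguments Gen {K X}.
Arguments Cst {K X}.
Arguments Add {K X}.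
Arguments Mul {K X}.

HB.instance Definition _ (K X : Type) := gen_eqMixin (expr K X).
HB.instance Definition _ (K X : Type) := gen_choiceMixin (expr K X).

Section PresentedAlgebra.
Variables (K : comNzRingType) (X : Type).
Variable r : expr K X -> expr K X -> Prop.

Inductive congruence : expr K X -> expr K X -> Prop :=
| cg_rel s t of r s t : congruence s t
| cg_refl s : congruence s s
| cg_sym s t of congruence s t : congruence t s
| cg_trans s t u of congruence s t & congruence t u : congruence s u
| cg_Add s s' t t' of congruence s s' & congruence t t' :
    congruence (Add s t) (Add s' t')
| cg_Mul s s' t t' of congruence s s' & congruence t t' :
    congruence (Mul s t) (Mul s' t')
| cg_addA s t u : congruence (Add s (Add t u)) (Add (Add s t) u)
| cg_addC s t : congruence (Add s t) (Add t s)
| cg_add0 s : congruence (Add (Cst 0) s) s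
| cg_addN s : congruence (Add (Mul (Cst (-1)) s) s) (Cst 0)
| cg_mulA s t u : congruence (Mul s (Mul t u)) (Mul (Mul s t) u)
| cg_mul1l s : congruence (Mul (Cst 1) s) s
| cg_mul1r s : congruence (Mul s (Cst 1)) s
| cg_mulDl s t u : congruence (Mul (Add s t) u) (Add (Mul s u) (Mul t u))
| cg_mulDr s t u : congruence (Mul s (Add t u)) (Add (Mul s t) (Mul s u))
| cg_cstD a b : congruence (Cst (a + b)) (Add (Cst a) (Cst b))
| cg_cstM a b : congruence (Cst (a * b)) (Mul (Cst a) (Cst b))
| cg_cstC a s : congruence (Mul (Cst a) s) (Mul s (Cst a)).

Definition congruenceb (s t : expr K X) : bool := `[< congruence s t >].

Lemma congruenceb_refl : reflexive congruenceb.
Proof. by move=> s; apply/asboolP; exact: cg_refl. Qed.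

Lemma congruenceb_sym : symmetric congruenceb.
Proof.
by move=> s t; apply/idP/idP => /asboolP h; apply/asboolP; exact: cg_sym.
Qed.

Lemma congruenceb_trans : transitive congruenceb.
Proof.
by move=> t s u /asboolP h /asboolP h'; apply/asboolP; exact: cg_trans h h'.
Qed.

Canonical congruence_equiv :=
  EquivRel congruenceb congruenceb_refl congruenceb_sym congruenceb_trans.
Canonical congruence_encModRel := defaultEncModRel congruenceb.

Definition palg : Type := {eq_quot congruenceb}.
HB.instance Definition _ := Choice.on palg.
HB.instance Definition _ : EqQuotient _ congruenceb palg := EqQuotient.on palg.

Lemma palg_eqP (s t : expr K X) : \pi_palg s = \pi_palg t <-> congruence s t.
Proof. by split=> [/eqmodP/asboolP//|h]; apply/eqmodP/asboolP. Qed.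

Lemma palg_repr (s : expr K X) : congruence (repr (\pi_palg s)) s.
Proof. by apply/palg_eqP; rewrite reprK. Qed.

Definition palg_zero : palg := \pi_palg (Cst 0).
Definition palg_one : palg := \pi_palg (Cst 1).
Definition palg_opp : palg -> palg := lift_op1 palg (Mul (Cst (-1))).
Definition palg_add : palg -> palg -> palg := lift_op2 palg Add.
Definition palg_mul : palg -> palg -> palg := lift_op2 palg Mul.
Definition palg_scale (k : K) : palg -> palg := lift_op1 palg (Mul (Cst k)).

Lemma pi_palg_opp s : palg_opp (\pi_palg s) = \pi_palg (Mul (Cst (-1)) s).
Proof.
unlock palg_opp; apply/palg_eqP.
by apply: cg_Mul; [exact: cg_refl|exact: palg_repr].
Qed.

Lemma pi_palg_add s t : palg_add (\pi_palg s) (\pi_palg t) = \pi_palg (Add s t).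
Proof. by unlock palg_add; apply/palg_eqP/cg_Add; exact: palg_repr. Qed.

Lemma pi_palg_mul s t : palg_mul (\pi_palg s) (\pi_palg t) = \pi_palg (Mul s t).
Proof. by unlock palg_mul; apply/palg_eqP/cg_Mul; exact: palg_repr. Qed.

Lemma pi_palg_scale k s : palg_scale k (\pi_palg s) = \pi_palg (Mul (Cst k) s).
Proof.
unlock palg_scale; apply/palg_eqP.
by apply: cg_Mul; [exact: cg_refl|exact: palg_repr].
Qed.

Lemma palg_addA : associative palg_add.
Proof.
move=> a b d; rewrite -[a]reprK -[b]reprK -[d]reprK !pi_palg_add.
by apply/palg_eqP/cg_addA.
Qed.

Lemma palg_addC : commutative palg_add.
Proof. by move=> a b; unlock palg_add; apply/palg_eqP/cg_addC. Qed.

Lemma palg_add0 : left_id palg_zero palg_add.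
Proof.
by move=> a; rewrite -[a]reprK pi_palg_add; apply/palg_eqP/cg_add0.
Qed.

Lemma palg_addN : left_inverse palg_zero palg_opp palg_add.
Proof.
move=> a; rewrite -[a]reprK pi_palg_opp pi_palg_add.
by apply/palg_eqP/cg_addN.
Qed.

Lemma palg_mulA : associative palg_mul.
Proof.
move=> a b d; rewrite -[a]reprK -[b]reprK -[d]reprK !pi_palg_mul.
by apply/palg_eqP/cg_mulA.
Qed.

Lemma palg_mul1l : left_id palg_one palg_mul.
Proof.
by move=> a; rewrite -[a]reprK pi_palg_mul; apply/palg_eqP/cg_mul1l.
Qed.

Lemma palg_mul1r : right_id palg_one palg_mul.
Proof.
by move=> a; rewrite -[a]reprK pi_palg_mul; apply/palg_eqP/cg_mul1r.
Qed.

Lemma palg_mulDl : left_distributive palg_mul palg_add.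
Proof.
move=> a b d; rewrite -[a]reprK -[b]reprK -[d]reprK.
rewrite !(pi_palg_add, pi_palg_mul).
by apply/palg_eqP/cg_mulDl.
Qed.

Lemma palg_mulDr : right_distributive palg_mul palg_add.
Proof.
move=> a b d; rewrite -[a]reprK -[b]reprK -[d]reprK.
rewrite !(pi_palg_add, pi_palg_mul).
by apply/palg_eqP/cg_mulDr.
Qed.

HB.instance Definition _ := GRing.isPzRing.Build palg
  palg_addA palg_addC palg_add0 palg_addN
  palg_mulA palg_mul1l palg_mul1r palg_mulDl palg_mulDr.

Lemma palg_scaleA (k l : K) a :
  palg_scale k (palg_scale l a) = palg_scale (k * l) a.
Proof.
rewrite -[a]reprK !pi_palg_scale; apply/palg_eqP.
apply: cg_trans (cg_mulA _ _ _) _.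
by apply: cg_Mul; [exact/cg_sym/cg_cstM|exact: cg_refl].
Qed.

Lemma palg_scale1 : left_id 1 palg_scale.
Proof.
by move=> a; rewrite -[a]reprK pi_palg_scale; apply/palg_eqP/cg_mul1l.
Qed.

Lemma palg_scaleDr : right_distributive palg_scale +%R.
Proof.
move=> k a b; change (a + b) with (palg_add a b).
change (palg_scale k a + palg_scale k b)
  with (palg_add (palg_scale k a) (palg_scale k b)).
rewrite -[a]reprK -[b]reprK !(pi_palg_add, pi_palg_scale).
by apply/palg_eqP/cg_mulDr.
Qed.

Lemma palg_scaleDl a : {morph palg_scale^~ a : k l / k + l}.
Proof.
move=> k l; change (palg_scale (k + l) a =
  palg_add (palg_scale k a) (palg_scale l a)).
rewrite -[a]reprK !(pi_palg_add, pi_palg_scale); apply/palg_eqP.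
apply: cg_trans (cg_mulDl _ _ _).
by apply: cg_Mul; [exact: cg_cstD|exact: cg_refl].
Qed.

HB.instance Definition _ := GRing.Zmodule_isLmodule.Build K palg
  palg_scaleA palg_scale1 palg_scaleDr palg_scaleDl.

Lemma palg_scalerAl (k : K) (a b : palg) : k *: (a * b) = (k *: a) * b.
Proof.
change (palg_scale k (palg_mul a b) = palg_mul (palg_scale k a) b).
rewrite -[a]reprK -[b]reprK !(pi_palg_mul, pi_palg_scale).
by apply/palg_eqP/cg_mulA.
Qed.

Lemma palg_scalerAr (k : K) (a b : palg) : k *: (a * b) = a * (k *: b).
Proof.
change (palg_scale k (palg_mul a b) = palg_mul a (palg_scale k b)).
rewrite -[a]reprK -[b]reprK !(pi_palg_mul, pi_palg_scale).
apply/palg_eqP; apply: cg_trans (cg_mulA _ _ _) _.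
apply: cg_trans (cg_sym (cg_mulA _ _ _)).
by apply: cg_Mul; [exact: cg_cstC|exact: cg_refl].
Qed.

Definition pcls (s : expr K X) : palg := \pi_palg s.
Definition pgen (x : X) : palg := pcls (Gen x).

Lemma pclsP s t : pcls s = pcls t <-> congruence s t.
Proof. exact: palg_eqP. Qed.

Lemma pcls_rel s t : r s t -> pcls s = pcls t.
Proof. by move=> h; apply/pclsP/cg_rel. Qed.

Lemma pclsD : {morph pcls : s t / Add s t >-> s + t}.
Proof. by move=> s t; exact/esym/pi_palg_add. Qed.

Lemma pclsM : {morph pcls : s t / Mul s t >-> s * t}.
Proof. by move=> s t; exact/esym/pi_palg_mul. Qed.

Lemma pclsZ k s : pcls (Mul (Cst k) s) = k *: pcls s.
Proof. exact/esym/pi_palg_scale. Qed.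

Lemma pclsC k : pcls (Cst k) = k *: (1 : palg).
Proof.
transitivity (k *: pcls (Cst 1)); last by [].
by rewrite -pclsZ; apply/pclsP/cg_sym/cg_mul1r.
Qed.

(* The cyclic left module palg / (palg * S). *)

Section CyclicModule.
Variable S : set palg.

Definition left_ideal : set palg := fun a =>
  forall I : set palg, I 0 -> (forall u v, I u -> I v -> I (u + v)) ->
    (forall u v, I v -> I (u * v)) -> S `<=` I -> I a.

Definition left_idealb : {pred palg} := fun a => `[< left_ideal a >].

Lemma left_idealD u v : left_ideal u -> left_ideal v -> left_ideal (u + v).
Proof.
move=> Ju Jv I I0 ID IM SI.
by apply: (ID u v); [exact: (Ju I I0 ID IM SI)|exact: (Jv I I0 ID IM SI)].
Qed.

Lemma left_idealM u v : left_ideal v -> left_ideal (u * v).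
Proof. by move=> Jv I I0 ID IM SI; apply/IM/(Jv I I0 ID IM SI). Qed.

Lemma left_ideal_zmod_closed : zmod_closed left_idealb.
Proof.
split=> [|u v /asboolP Ju /asboolP Jv]; apply/asboolP.
  by move=> I I0 _ _ _.
by apply: left_idealD => //; rewrite -mulN1r; exact: left_idealM.
Qed.

HB.instance Definition _ :=
  GRing.isZmodClosed.Build palg left_idealb left_ideal_zmod_closed.

Definition cycmod : Type := Quotient.quot left_idealb.
HB.instance Definition _ := GRing.Zmodule.on cycmod.

Definition cyc_pi (a : palg) : cycmod := \pi_(Quotient.quot left_idealb) a.

Definition cyc_act (a : palg) (p : cycmod) : cycmod := cyc_pi (a * repr p).

Lemma cyc_piP a b : cyc_pi a = cyc_pi b <-> left_ideal (a - b).
Proof.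
have E : (a - b \in left_idealb) = (cyc_pi a == cyc_pi b).
  exact: Quotient.idealrBE.
by split=> [/eqP|/asboolP h]; [rewrite -E => /asboolP|apply/eqP; rewrite -E].
Qed.

Lemma cyc_act_pi a b : cyc_act a (cyc_pi b) = cyc_pi (a * b).
Proof.
apply/cyc_piP; rewrite -mulrBr; apply: left_idealM.
by apply/cyc_piP; exact: reprK.
Qed.

Lemma cyc_piK p : cyc_pi (repr p) = p.
Proof. exact: reprK. Qed.

Lemma cyc_piD a b : cyc_pi (a + b) = cyc_pi a + cyc_pi b.
Proof. exact: Quotient.pi_add. Qed.

Definition cyc_scale (k : K) (p : cycmod) : cycmod :=
  cyc_act (k *: (1 : palg)) p.

Lemma cyc_actA a b p : cyc_act a (cyc_act b p) = cyc_act (a * b) p.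
Proof. by rewrite -[p]cyc_piK !cyc_act_pi mulrA. Qed.

Lemma cyc_act1 p : cyc_act 1 p = p.
Proof. by rewrite /cyc_act mul1r cyc_piK. Qed.

Lemma cyc_actDr a p q : cyc_act a (p + q) = cyc_act a p + cyc_act a q.
Proof.
by rewrite -[p]cyc_piK -[q]cyc_piK -cyc_piD !cyc_act_pi mulrDr cyc_piD.
Qed.

Lemma cyc_actDl a b p : cyc_act (a + b) p = cyc_act a p + cyc_act b p.
Proof. by rewrite /cyc_act mulrDl cyc_piD. Qed.

Lemma cyc_scaleA (k l : K) p :
  cyc_scale k (cyc_scale l p) = cyc_scale (k * l) p.
Proof. by rewrite /cyc_scale cyc_actA -palg_scalerAl mul1r scalerA. Qed.

Lemma cyc_scale1 : left_id 1 cyc_scale.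
Proof. by move=> p; rewrite /cyc_scale scale1r cyc_act1. Qed.

Lemma cyc_scaleDr : right_distributive cyc_scale +%R.
Proof. by move=> k p q; rewrite /cyc_scale cyc_actDr. Qed.

Lemma cyc_scaleDl p : {morph cyc_scale^~ p : k l / k + l}.
Proof. by move=> k l; rewrite /cyc_scale scalerDl cyc_actDl. Qed.

HB.instance Definition _ := GRing.Zmodule_isLmodule.Build K cycmod
  cyc_scaleA cyc_scale1 cyc_scaleDr cyc_scaleDl.

Lemma cyc_actZ (k : K) a p : cyc_act (k *: a) p = k *: cyc_act a p.
Proof.
transitivity (cyc_act (k *: (1 : palg)) (cyc_act a p)); last by [].
by rewrite cyc_actA -palg_scalerAl mul1r.
Qed.

Lemma cyc_act0 p : cyc_act 0 p = 0.
Proof. by rewrite -(scale0r (0 : palg)) cyc_actZ scale0r. Qed.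

Lemma cyc_act_sum (I : Type) (w : seq I) (F : I -> palg) p :
  cyc_act (\sum_(i <- w) F i) p = \sum_(i <- w) cyc_act (F i) p.
Proof.
by apply: (big_morph (cyc_act^~ p)); [move=> a b; exact: cyc_actDl|
                                      exact: cyc_act0].
Qed.

Lemma cyc_act_gen a : S a -> cyc_act a (cyc_pi 1) = 0.
Proof.
move=> Sa; rewrite cyc_act_pi mulr1 -(cyc_act0 (cyc_pi 1)) cyc_act_pi mul0r.
by apply/cyc_piP; rewrite subr0 => I _ _ _; exact.
Qed.

End CyclicModule.

Definition lie_bracket (a b : palg) : palg := a * b - b * a.

Definition lie_subalgebra (W : set palg) : Prop :=
  [/\ W 0, forall (k : K) a b, W a -> W b -> W (k *: a + b)
   & forall a b, W a -> W b -> W (lie_bracket a b)].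

Definition lie_generated (S : set palg) : set palg :=
  [set a | forall W, lie_subalgebra W -> S `<=` W -> W a].

Definition centraliser (S : set palg) : set palg :=
  [set a | forall b, S b -> a * b = b * a].

(* rho is only constrained on g. *)
Definition lie_representation (g : set palg) (L : lmodType K)
    (rho : palg -> L -> L) : Prop :=
  [/\ forall a (k : K) p q, g a -> rho a (k *: p + q) = k *: rho a p + rho a q,
      forall (k : K) a b p, g a -> g b ->
        rho (k *: a + b) p = k *: rho a p + rho b p
    & forall a b p, g a -> g b ->
        rho (lie_bracket a b) p = rho a (rho b p) - rho b (rho a p)].

End PresentedAlgebra.

Section Modules.
Variable K : comNzRingType.

Definition linear_subspace (M : lmodType K) (W : set M) : Prop :=
  W 0 /\ forall (k : K) p q, W p -> W q -> W (k *: p + q).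

Definition submodule (A : Type) (M : lmodType K) (g : set A)
    (act : A -> M -> M) (W : set M) : Prop :=
  linear_subspace W /\ forall a p, g a -> W p -> W (act a p).

Definition irreducible_submodule (A : Type) (M : lmodType K) (g : set A)
    (act : A -> M -> M) (W : set M) : Prop :=
  [/\ submodule g act W, exists2 p, W p & p <> 0
    & forall W' : set M, submodule g act W' -> W' `<=` W ->
        W' = [set 0] \/ W' = W].

Definition one_dimensional (M : lmodType K) (W : set M) : Prop :=
  exists2 p, p <> 0 & W = [set k *: p | k in [set: K]].

Definition bilinear_on (U L T : lmodType K) (S : set U) (b : U -> L -> T) :
    Prop :=
  (forall (k : K) u u' l, S u -> S u' ->
     b (k *: u + u') l = k *: b u l + b u' l) /\
  (forall (k : K) u l l', S u -> b u (k *: l + l') = k *: b u l + b u l').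

(* (T, tau) is the tensor product of the subspace S of U with L. *)
Definition is_tensor_product (U L T : lmodType K) (S : set U)
    (tau : U -> L -> T) : Prop :=
  bilinear_on S tau /\
  forall (N : lmodType K) (b : U -> L -> N), bilinear_on S b ->
    exists f : {linear T -> N}, (forall u l, S u -> f (tau u l) = b u l) /\
      forall f' : {linear T -> N},
        (forall u l, S u -> f' (tau u l) = b u l) -> f' =1 f.

Definition is_direct_sum (I : Type) (T : I -> lmodType K) (M : lmodType K)
    (iota : forall i, {linear T i -> M}) : Prop :=
  forall (N : lmodType K) (f : forall i, {linear T i -> N}),
    exists F : {linear M -> N}, (forall i t, F (iota i t) = f i t) /\
      forall F' : {linear M -> N},
        (forall i t, F' (iota i t) = f i t) -> F' =1 F.

End Modules.

(* E is the space of real column vectors of size 2 and E^* that of row vectors,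
   with the matrix product as pairing; g acts on E by g v and on E^* by
   f g^-1. *)

Section Dihedral.
Variables (R : realType) (m : nat).
Local Notation C := R[i].

Definition angle (j : nat) : R := pi * j%:R / m%:R.

Definition root_vec (j : nat) : 'cV[R]_2 :=
  sin (angle j) *: delta_mx 0 0 - cos (angle j) *: delta_mx 1 0.

Definition root_cov (j : nat) : 'rV[R]_2 :=
  sin (angle j) *: delta_mx 0 0 - cos (angle j) *: delta_mx 0 1.

Definition refl_mx (j : nat) : 'M[R]_2 :=
  1 - 2 *: (root_vec j *m root_cov j).

Definition in_dihedral (A : 'M[R]_2) : Prop :=
  exists2 w : seq nat, all (fun j => (1 <= j <= m)%N) w &
    A = \prod_(j <- w) refl_mx j.

Definition in_dihedralb : pred 'M[R]_2 := fun A => `[< in_dihedral A >].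

Record dihedral : Type :=
  Dihedral { dihedral_mx :> 'M[R]_2; _ : in_dihedralb dihedral_mx }.

HB.instance Definition _ := [isSub for dihedral_mx].
HB.instance Definition _ := [Choice of dihedral by <:].

Lemma root_covK j : root_cov j *m root_vec j = 1%:M.
Proof.
apply/matrixP => i k; rewrite !ord1 !mxE /=.
rewrite !big_ord_recl big_ord0 !mxE /=.
by rewrite !mulr1 !mulr0 !subr0 !sub0r mulrNN addr0 -!expr2 addrC cos2Dsin2.
Qed.

Lemma refl_mxK j : refl_mx j * refl_mx j = 1.
Proof.
rewrite /refl_mx; set P := root_vec j *m root_cov j.
have PP : P * P = P.
  rewrite -mulmxE /P mulmxA -(mulmxA (root_vec j)) root_covK.
  by rewrite mulmx1.
rewrite mulrBl mul1r mulrBr mulr1 -scalerAl -scalerAr PP scalerA.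
have -> : (2 * 2 : R) *: P = 2 *: P + 2 *: P.
  by rewrite -scalerDl -mulr2n mulr_natl.
by rewrite opprB addrK subrK.
Qed.

Lemma in_dihedral1 : in_dihedralb 1.
Proof. by apply/asboolP; exists [::] => //; rewrite big_nil. Qed.

Lemma in_dihedralM A B :
  in_dihedralb A -> in_dihedralb B -> in_dihedralb (A * B).
Proof.
move=> /asboolP[w hw ->] /asboolP[w' hw' ->]; apply/asboolP.
by exists (w ++ w'); rewrite ?all_cat ?hw // big_cat.
Qed.

Lemma prod_refl_rev (w : seq nat) :
  (\prod_(j <- rev w) refl_mx j) * (\prod_(j <- w) refl_mx j) = 1.
Proof.
elim: w => [|j w IHw]; first by rewrite !big_nil mulr1.
rewrite rev_cons -cats1 big_cat big_seq1 big_cons /=.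
by rewrite mulrA -[X in X * _]mulrA refl_mxK mulr1 IHw.
Qed.

Lemma in_dihedralV A : in_dihedralb A -> in_dihedralb (invmx A) /\
  invmx A * A = 1.
Proof.
move=> /asboolP[w hw ->].
have h := prod_refl_rev w.
set P := (X in _ * X = _) in h *; have [_ uP] := mulmx1_unit h.
have e : P * invmx P = 1 := mulmxV uP.
have -> : invmx P = \prod_(j <- rev w) refl_mx j.
  by rewrite -[LHS]mul1r -[X in X * _]h -mulrA e mulr1.
by split=> //; apply/asboolP; exists (rev w); rewrite ?all_rev.
Qed.

Definition dih_one : dihedral := Dihedral in_dihedral1.
Definition dih_mul (g h : dihedral) : dihedral :=
  Dihedral (in_dihedralM (valP g) (valP h)).
Definition dih_inv (g : dihedral) : dihedral :=
  Dihedral (in_dihedralV (valP g)).1.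

Lemma dih_mulA : associative dih_mul.
Proof. by move=> g h k; apply: val_inj; exact: mulrA. Qed.
Lemma dih_mul1l : left_id dih_one dih_mul.
Proof. by move=> g; apply: val_inj; exact: mul1r. Qed.
Lemma dih_mul1r : right_id dih_one dih_mul.
Proof. by move=> g; apply: val_inj; exact: mulr1. Qed.
Lemma dih_mulVl : left_inverse dih_one dih_inv dih_mul.
Proof. by move=> g; apply: val_inj; exact: (in_dihedralV (valP g)).2. Qed.
Lemma dih_mulVr : right_inverse dih_one dih_inv dih_mul.
Proof.
by move=> g; apply: val_inj; exact/mulmx1C/(in_dihedralV (valP g)).2.
Qed.

HB.instance Definition _ := isGroup.Build dihedral
  dih_mulA dih_mul1l dih_mul1r dih_mulVl dih_mulVr.

(* Only 1 <= j <= m matters; the value 1 at other j makes the function total. *)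
Definition srefl (j : nat) : dihedral := insubd (1%g : dihedral) (refl_mx j).

Lemma val_srefl j : (1 <= j <= m)%N -> val (srefl j) = refl_mx j.
Proof.
move=> hj; rewrite /srefl val_insubd ifT //.
by apply/asboolP; exists [:: j]; rewrite /= ?hj // big_seq1.
Qed.

Definition class_function (c : dihedral -> C) : Prop :=
  forall (g : dihedral) j, (1 <= j <= m)%N -> c (srefl j ^ g)%g = c (srefl j).

(* The representation of the group on C given by chi. *)
Definition linear_character (chi : dihedral -> C) : Prop :=
  chi 1%g = 1 /\ forall g h : dihedral, chi (g * h)%g = chi g * chi h.

Definition act_vec (g : dihedral) (v : 'cV[C]_2) : 'cV[C]_2 :=
  map_mx (real_complex R) (val g) *m v.

Definition act_cov (g : dihedral) (f : 'rV[C]_2) : 'rV[C]_2 :=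
  f *m map_mx (real_complex R) (val g^-1%g).

Definition pairing (f : 'rV[C]_2) (v : 'cV[C]_2) : C := (f *m v) 0 0.

Definition root_vecC (j : nat) : 'cV[C]_2 :=
  map_mx (real_complex R) (root_vec j).
Definition root_covC (j : nat) : 'rV[C]_2 :=
  map_mx (real_complex R) (root_cov j).

Inductive cherednik_gen : Type :=
| Vec of 'cV[C]_2
| Cov of 'rV[C]_2
| Grp of dihedral.

Section Cherednik.
Variable c : dihedral -> C.

Local Notation vec v := (Gen (Vec v)).
Local Notation cov f := (Gen (Cov f)).
Local Notation grp g := (Gen (Grp g)).

(* The first six relations present the algebra T(E_C + E_C^* ) x| G, the other
   three are the relations of the Cherednik algebra. *)
Inductive cherednik_rel :
  expr C cherednik_gen -> expr C cherednik_gen -> Prop :=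
| rel_vec_lin (a : C) v w :
    cherednik_rel (vec (a *: v + w)) (Add (Mul (Cst a) (vec v)) (vec w))
| rel_cov_lin (a : C) f f' :
    cherednik_rel (cov (a *: f + f')) (Add (Mul (Cst a) (cov f)) (cov f'))
| rel_grp1 : cherednik_rel (grp 1%g) (Cst 1)
| rel_grpM (g h : dihedral) :
    cherednik_rel (grp (g * h)%g) (Mul (grp g) (grp h))
| rel_grp_vec g v :
    cherednik_rel (Mul (grp g) (vec v)) (Mul (vec (act_vec g v)) (grp g))
| rel_grp_cov g f :
    cherednik_rel (Mul (grp g) (cov f)) (Mul (cov (act_cov g f)) (grp g))
| rel_vecC v w : cherednik_rel (Mul (vec v) (vec w)) (Mul (vec w) (vec v))
| rel_covC f f' : cherednik_rel (Mul (cov f) (cov f')) (Mul (cov f') (cov f))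
| rel_vec_cov v f :
    cherednik_rel
      (Add (Mul (vec v) (cov f)) (Mul (Cst (-1)) (Mul (cov f) (vec v))))
      (Add (Cst (pairing f v))
        (Mul (Cst (-2)) (\big[Add/Cst 0]_(1 <= j < m.+1)
           Mul (Cst (c (srefl j) * pairing f (root_vecC j) *
                     pairing (root_covC j) v))
               (grp (srefl j))))).

Definition cherednik : Type := palg cherednik_rel.
HB.instance Definition _ := GRing.PzRing.on cherednik.
HB.instance Definition _ := GRing.Lmodule.on cherednik.

Definition hvec (v : 'cV[C]_2) : cherednik := pgen cherednik_rel (Vec v).
Definition hcov (f : 'rV[C]_2) : cherednik := pgen cherednik_rel (Cov f).
Definition hgrp (g : dihedral) : cherednik := pgen cherednik_rel (Grp g).

Lemma hvec_hcov (v : 'cV[C]_2) (f : 'rV[C]_2) :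
  hvec v * hcov f - hcov f * hvec v =
  pairing f v *: (1 : cherednik) - 2 *: \sum_(1 <= j < m.+1)
    (c (srefl j) * pairing f (root_vecC j) * pairing (root_covC j) v) *:
      hgrp (srefl j).
Proof.
have := pcls_rel (rel_vec_cov v f).
rewrite !(pclsD, pclsZ, pclsM) pclsC scaleN1r scaleNr => -> /=.
congr (_ - 2 *: _).
rewrite (big_morph _ (@pclsD _ _ _) (erefl : pcls cherednik_rel (Cst 0) = 0)).
by apply: eq_bigr => j _; rewrite pclsZ.
Qed.

Definition hxi : cherednik := hvec (delta_mx 0 0).
Definition heta : cherednik := hvec (delta_mx 1 0).
Definition hx : cherednik := hcov (delta_mx 0 0).
Definition hy : cherednik := hcov (delta_mx 0 1).

Definition imag : C := 'i%C.

Definition hz : cherednik := hx + imag *: hy.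
Definition hzbar : cherednik := hx - imag *: hy.
Definition hzeta : cherednik := 2^-1 *: (hxi - imag *: heta).
Definition hzetabar : cherednik := 2^-1 *: (hxi + imag *: heta).

Definition omega : C :=
  cos (2 * pi / m%:R) +i* sin (2 * pi / m%:R).

Definition sigma (k : nat) : cherednik :=
  \sum_(1 <= j < m.+1) (c (srefl j) * omega ^+ (k * j)) *: hgrp (srefl j).

Definition Eplus : cherednik := 2^-1 *: (hz * hzbar).
Definition Eminus : cherednik := (-2) *: (hzeta * hzetabar).
Definition Hop : cherednik := hz * hzeta + hzbar * hzetabar + 1 - sigma 0.
Definition Z0 : cherednik := hzbar * hzetabar - hz * hzeta.
Definition Zeps (eps : R) : cherednik := Z0 + eps%:C *: sigma 0.

Definition u11 (eps : R) : set cherednik :=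
  lie_generated [set h | [\/ h = Eplus, h = Eminus, h = Hop | h = Zeps eps]].

Definition Vcent (eps : R) : set cherednik := centraliser (u11 eps).

(* L is the irreducible lowest weight representation of u(1,1) with lowest
   weight (mu, nu). *)
Definition is_lowest_weight_irrep (eps : R) (mu nu : C) (L : lmodType C)
    (rho : cherednik -> L -> L) : Prop :=
  [/\ lie_representation (u11 eps) rho,
      irreducible_submodule (u11 eps) rho [set: L]
    & exists2 l, l <> 0 &
        [/\ rho Eminus l = 0, rho Hop l = mu *: l
          & rho (Zeps eps) l = nu *: l]].

Definition is_star (star : cherednik -> cherednik) : Prop :=
  [/\ forall (a : C) h h', star (a *: h + h') = a^*%C *: star h + star h',
      forall h h', star (h * h') = star h' * star h,
      involutive star,
      [/\ star hxi = hx, star hx = hxi, star heta = hy & star hy = heta]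
    & forall j, (1 <= j <= m)%N -> star (hgrp (srefl j)) = hgrp (srefl j)].

Section Standard.
Variable chi : dihedral -> C.

(* The left ideal is generated by E and the g - chi(g): as C_chi is cyclic with
   this annihilator, the quotient is the module induced from C_chi. *)
Definition std_annihilator : set cherednik :=
  [set h | (exists v, h = hvec v) \/
           (exists g, h = hgrp g - chi g *: (1 : cherednik))].

Definition standard : Type := cycmod std_annihilator.
HB.instance Definition _ := GRing.Lmodule.on standard.

Definition std_act (h : cherednik) (p : standard) : standard :=
  @cyc_act _ _ cherednik_rel std_annihilator h p.

Definition std_vec : standard := @cyc_pi _ _ cherednik_rel std_annihilator 1.

Definition std_chi : set standard := [set a *: std_vec | a in [set: C]].

Definition std_irreducible : Prop :=
  irreducible_submodule [set: cherednik] std_act [set: standard].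

Definition std_unitarisable : Prop :=
  exists2 star, is_star star & exists beta : standard -> standard -> C,
    [/\ forall (a : C) p p' q, beta (a *: p + p') q = a * beta p q + beta p' q,
        forall p q, beta q p = (beta p q)^*%C,
        forall h p q, beta (std_act h p) q = beta p (std_act (star h) q),
        forall g p q, std_chi p -> std_chi q ->
          beta (std_act (hgrp g) p) (std_act (hgrp g) q) = beta p q
      & forall p, p <> 0 -> 0 < beta p p].

Definition sigma_chi (k : nat) : C :=
  \sum_(1 <= j < m.+1) c (srefl j) * omega ^+ (k * j) * chi (srefl j).

Lemma std_act_vec v : std_act (hvec v) std_vec = 0.
Proof. by apply: cyc_act_gen; left; exists v. Qed.

Lemma std_act_grp g : std_act (hgrp g) std_vec = chi g *: std_vec.
Proof.
have : std_act (hgrp g - chi g *: (1 : cherednik)) std_vec = 0.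
  by apply: cyc_act_gen; right; exists g.
rewrite /std_act cyc_actDl -scaleNr cyc_actZ cyc_act1 scaleNr.
by move/eqP; rewrite subr_eq0 => /eqP.
Qed.

Lemma std_act_sigma k : std_act (sigma k) std_vec = sigma_chi k *: std_vec.
Proof.
rewrite /std_act cyc_act_sum scaler_suml; apply: eq_bigr => j _.
by rewrite cyc_actZ -scalerA; congr (_ *: _); exact: std_act_grp.
Qed.

Definition Nchi : C := sigma_chi 0.

Definition lambda (eps : R) (k : int) : C :=
  if k == 0 then eps%:C * sigma_chi 0 else
  (sgz k)%:~R *
  sqrtC (((`|k|%N)%:R - Nchi) ^+ 2 - (1 - eps%:C ^+ 2) * sigma_chi `|k|%N ^+ 2).

Definition harm_eigenspace (eps : R) (k : int) : set standard :=
  if k == 0 then std_chi else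
  [set p | std_act Eminus p = 0 /\
           std_act (Zeps eps) p = lambda eps k *: p].

(* M is the direct sum of the H_k (x) L_k, where the centraliser acts on H_k
   and u(1,1) on L_k. *)
Definition joint_decomposition (eps : R) : Prop :=
  exists (L T : int -> lmodType C)
    (rho : forall k, cherednik -> L k -> L k)
    (tau : forall k, standard -> L k -> T k)
    (iota : forall k, {linear T k -> standard}),
  [/\ forall k, is_lowest_weight_irrep eps
                  ((`|k|%N)%:R + 1 - Nchi) (lambda eps k) (rho k),
      forall k, is_tensor_product (harm_eigenspace eps k) (tau k),
      is_direct_sum iota,
      forall k v p l, Vcent eps v -> harm_eigenspace eps k p ->
        iota k (tau k (std_act v p) l) = std_act v (iota k (tau k p l))
    & forall k u p l, u11 eps u -> harm_eigenspace eps k p ->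
        iota k (tau k p (rho k u l)) = std_act u (iota k (tau k p l))].

End Standard.
End Cherednik.
End Dihedral.

Arguments srefl {R m} j.
Arguments Vcent {R m} c eps.
Arguments std_act {R m} c chi h p.
Arguments harm_eigenspace {R m} c chi eps k.

(* Main.v *)
From HB Require Import structures.
Require Import Defs.
From mathcomp Require Import all_boot all_order all_algebra complex.
From mathcomp Require Import all_classical all_reals all_analysis.
From mathcomp Require Import ring lra.

Set Implicit Arguments.
Unset Strict Implicit.
Unset Printing Implicit Defensive.

Import Order.TTheory GRing.Theory Num.Theory.

(** Write z, w for the coordinates z and its conjugate, a, b for the Dunkl
operators zeta and its conjugate, all acting on the standard module M with
generator v, and put N = chi(sigma(0)), t_n = chi(sigma(n)).

In each degree n > 0 the kernel of E_- is a plane, spanned by the harmonic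
projections x_n and y_n of z^n v and w^n v. These projections are produced by
the recursion x_(n+1) = z g_n with g_n = x_n - (n - N)^-1 w b x_n, and its
mirror image for y_n ([harm]). The point is that b g_n = 0: the vector b g_n
is harmonic of degree n - 1 and w b g_n = 0, whereas E_- E_+ acts on harmonic
vectors of that degree by the non-zero scalar N - n ([harmonic_lower_eq0]).
From b g_n = 0 it follows at once that z g_n is again harmonic and that w b
x_(n+1) = sigma x_(n+1). A reflection exchanges x_n and y_n up to a scalar
([refl_harm]), so that sigma x_n = t_n y_n and sigma y_n = t_n x_n. Hence Z_0
+ eps sigma acts on the plane by an explicit matrix of size two, with square
the scalar (n - N)^2 - (1 - eps^2) t_n^2, and its eigenvectors p_n and p_(-n)
for the eigenvalues lambda_n and lambda_(-n) are explicit ([lwv]).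

The vectors x_n and y_n are independent because Z_0 anticommutes with the
reflection s_m, which exchanges them up to sign: a linear relation would give
y_n = x_n or y_n = - x_n, and then n - N = t_n or n - N = - t_n, which fails
when c is small ([harm_free]). They do not vanish because a x_(n+1) is a
non-zero multiple of g_n ([harm_neq0]). Finally the span of all E_+^j x_n and
E_+^j y_n is stable under the generators of the algebra and contains v, so it
is M ([std_span_full]).

For c small, lambda_k lies within 1/4 of k ([real_lambda_near]), so the
numbers lambda_k are distinct and the eigenspaces of Z_0 + eps sigma split M
into the orbits of the p_k under E_+. The weights |k| + 1 - N + j do not
vanish, so E_- climbs down each orbit without losing a vector; the orbit is
then an irreducible lowest weight module, modelled here on the polynomials in
E_+ ([lw_rep]). The centraliser of u(1,1) preserves the kernel of E_- and the
eigenspaces of Z_0 + eps sigma, hence each line spanned by p_k, and it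
commutes with E_+, which makes the decomposition one of bimodules. *)

Local Open Scope complex_scope.
Local Open Scope ring_scope.

(** * Linear identities in a module *)

(** Syntax of linear combinations, for proving vector identities by comparing
the coefficient of each atom: [lmod_with] reduces an identity in a module to
scalar identities, which [ring] or [field] can then settle. *)
Inductive lterm (K : Type) : Type :=
| LVar of nat
| LZero
| LAdd of lterm K & lterm K
| LOpp of lterm K
| LScale of K & lterm K.
Arguments LVar {K}.
Arguments LZero {K}.

Section LTerm.
Variables (K : pzRingType) (V : lmodType K).

Fixpoint lval (e : seq V) (t : lterm K) : V :=
  match t with
  | LVar i => nth 0 e i
  | LZero => 0
  | LAdd t u => lval e t + lval e u
  | LOpp t => - lval e t
  | LScale k t => k *: lval e t
  end.

Fixpoint lcoef (i : nat) (t : lterm K) : K :=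
  match t with
  | LVar j => if Nat.eqb i j then 1 else 0
  | LZero => 0
  | LAdd t u => lcoef i t + lcoef i u
  | LOpp t => - lcoef i t
  | LScale k t => k * lcoef i t
  end.

Fixpoint lsame (n : nat) (t u : lterm K) : Prop :=
  if n is n'.+1 then lcoef n' t = lcoef n' u /\ lsame n' t u else True.

Lemma lvalE e t : lval e t = \sum_(i < size e) lcoef i t *: e`_i.
Proof.
elim: t => [j||t IHt u IHu|t IHt|k t IHt] /=.
- case: (ltnP j (size e)) => hj.
    rewrite (bigD1 (Ordinal hj)) //= PeanoNat.Nat.eqb_refl scale1r.
    rewrite big1 ?addr0 // => i; rewrite -val_eqE /= => /eqP ij.
    by case: (PeanoNat.Nat.eqb_spec i j) => // _; rewrite scale0r.
  rewrite nth_default // big1 // => i _.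
  case: (PeanoNat.Nat.eqb_spec i j) => [ij|_]; last by rewrite scale0r.
  by move: (ltn_ord i); rewrite ij ltnNge hj.
- by rewrite big1 // => i _; rewrite scale0r.
- by rewrite IHt IHu -big_split; apply: eq_bigr => i _; rewrite scalerDl.
- by rewrite IHt -sumrN; apply: eq_bigr => i _; rewrite scaleNr.
- by rewrite IHt scaler_sumr; apply: eq_bigr => i _; rewrite scalerA.
Qed.

Lemma lsameP e t u : lsame (size e) t u -> lval e t = lval e u.
Proof.
rewrite !lvalE => h; apply: eq_bigr => i _; congr (_ *: _).
elim: (size e) i h => [|n IHn] i; first by case: i.
move=> /= [hn /IHn h]; case: (ltnP i n) => hi; first exact: (h (Ordinal hi)).
by have -> : (i : nat) = n by apply/eqP; rewrite eqn_leq hi -ltnS ltn_ord.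
Qed.
End LTerm.

(** Atoms are compared up to conversion, since one vector can occur with
several forms of the coercion from linear maps to functions. *)
Ltac lmod_index x e :=
  match e with
  | ?y :: _ => let _ := lazymatch constr:(Set) with _ => unify x y end in
      constr:(0%N)
  | _ :: ?e' => let n := lmod_index x e' in constr:(S n)
  end.

Ltac lmod_env t e :=
  lazymatch t with
  | (?a + ?b)%R => let e' := lmod_env a e in lmod_env b e'
  | (- ?a)%R => lmod_env a e
  | (?k *: ?a)%R => lmod_env a e
  | 0%R => e
  | ?x => match e with
      | _ => let n := lmod_index x e in e
      | _ => constr:(x :: e)
      end
  end.

Ltac lmod_quote K t e :=
  lazymatch t with
  | (?a + ?b)%R =>
      let a' := lmod_quote K a e in let b' := lmod_quote K b e in
      constr:(@LAdd K a' b')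
  | (- ?a)%R => let a' := lmod_quote K a e in constr:(@LOpp K a')
  | (?k *: ?a)%R => let a' := lmod_quote K a e in constr:(@LScale K k a')
  | 0%R => constr:(@LZero K)
  | ?x => let n := lmod_index x e in constr:(@LVar K n)
  end.

Ltac lmod_with K V :=
  lazymatch goal with
  | |- @eq _ ?t ?u =>
      let e0 := constr:(@nil V) in
      let e1 := lmod_env t e0 in let e := lmod_env u e1 in
      let t' := lmod_quote K t e in let u' := lmod_quote K u e in
      change (@lval K V e t' = @lval K V e u');
      apply: lsameP; rewrite /=; do ?split
  end.

(** * Dunkl operators of a dihedral group *)

Section Dunkl.
Variables (K : numFieldType) (V : lmodType K).
Local Ltac lmod := lmod_with K V.

(** Uses a known equation in a proof by normalisation: it remains to check
that the two differences agree formally. *)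
Lemma eq_of_sub (W : zmodType) (l r x y : W) : l = r -> x - y = l - r -> x = y.
Proof. by move=> -> /eqP; rewrite subrr subr_eq0 => /eqP. Qed.

(** The commutation relations of z, w, a, b with sg = sigma(0), sp = sigma(1)
and sm = sigma(-1). They are symmetric under the exchange of z, a, sp with w,
b, sm, so that every statement about x_n has a mirror image for y_n. *)
Record dunkl (z w a b sg sp sm : {linear V -> V}) : Prop := Dunkl {
  dk_zw : forall p, z (w p) = w (z p);
  dk_ab : forall p, a (b p) = b (a p);
  dk_az : forall p, a (z p) = z (a p) + p - sg p;
  dk_bw : forall p, b (w p) = w (b p) + p - sg p;
  dk_aw : forall p, a (w p) = w (a p) + sm p;
  dk_bz : forall p, b (z p) = z (b p) + sp p;
  dk_sgz : forall p, sg (z p) = w (sp p);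
  dk_sgw : forall p, sg (w p) = z (sm p);
  dk_sga : forall p, sg (a p) = b (sm p);
  dk_sgb : forall p, sg (b p) = a (sp p);
  dk_spa : forall p, sp (a p) = b (sg p);
  dk_smb : forall p, sm (b p) = a (sg p);
  dk_spw : forall p, sp (w p) = z (sg p);
  dk_smz : forall p, sm (z p) = w (sg p)
}.

Lemma dunkl_swap z w a b sg sp sm :
  dunkl z w a b sg sp sm -> dunkl w z b a sg sm sp.
Proof. by case=> *; split. Qed.

Definition harmonic (a b : V -> V) p := a (b p) = 0.

(** This is the eigenvector equation of the Euler operator H - 1 = z a + w b -
sigma, with the term in sigma kept on the right. *)
Definition homogeneous (z w a b sg : V -> V) (d : K) p :=
  z (a p) + w (b p) = d *: p + sg p.

(** The harmonic projection of z^n v: since b maps harmonic vectors of degree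
n to harmonic vectors of degree n - 1, on which E_- E_+ is the scalar N - n,
the subtracted term is the E_+ part of z times the preceding vector. For n = 0
the inverse may be that of 0, but then b v = 0. *)
Fixpoint harm (z w b : V -> V) (N : K) (v : V) (n : nat) : V :=
  if n is n'.+1 then
    z (harm z w b N v n' - (n'%:R - N)^-1 *: w (b (harm z w b N v n')))
  else v.

Lemma dk_azw z w a b sg sp sm (D : dunkl z w a b sg sp sm) p :
  a (z (w p)) = z (w (a p)) + w p.
Proof. by rewrite (dk_az D) (dk_aw D) linearD (dk_sgw D) /= addrAC addrK. Qed.

Lemma dk_bzw z w a b sg sp sm (D : dunkl z w a b sg sp sm) p :
  b (z (w p)) = z (w (b p)) + z p.
Proof. by rewrite !(dk_zw D) (dk_azw (dunkl_swap D)). Qed.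

Section Step.
Variables (z w a b sg sp sm : {linear V -> V}).
Hypothesis D : dunkl z w a b sg sp sm.

(** The relation [E_-, E_+] = - H, up to the factors in E_- and E_+. *)
Lemma dk_bazw p :
  a (b (z (w p))) = z (w (a (b p))) + (z (a p) + w (b p) + p - sg p).
Proof.
rewrite (dk_bzw D) linearD /= (dk_azw D) (dk_az D) -!addrA; congr (_ + _).
by rewrite addrCA.
Qed.

Lemma harmonic_raise p d :
  harmonic a b p -> homogeneous z w a b sg d p ->
  a (b (z (w p))) = (d + 1) *: p.
Proof.
move=> hp gp; rewrite dk_bazw hp !linear0 add0r gp.
by rewrite addrAC addrK scalerDl scale1r.
Qed.

Lemma homogeneous_lower p d :
  homogeneous z w a b sg d p -> homogeneous z w a b sg (d - 1) (b p).
Proof.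
move=> gp; rewrite /homogeneous.
have /esym := congr1 b gp; rewrite !linearD linearZ /= (dk_bz D) (dk_bw D).
rewrite (dk_spa D) (dk_ab D) => e.
by apply: (eq_of_sub (esym e)); lmod; ring.
Qed.

(** The vector b g is harmonic of degree d - 1, and E_+ (b g) = 0 because w (b
g) = 0; applying E_- gives d (b g) = 0. *)
Lemma harmonic_lower_eq0 g d : d != 0 ->
  harmonic a b g -> homogeneous z w a b sg d g -> w (b g) = 0 -> b g = 0.
Proof.
move=> d0 hg gg wbg.
have := @harmonic_raise (b g) (d - 1) _ (homogeneous_lower gg).
rewrite /harmonic (dk_ab D (b g)) hg linear0 => /(_ erefl).
rewrite wbg !linear0 subrK => /esym/eqP.
by rewrite scaler_eq0 (negbTE d0) => /eqP.
Qed.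

(** The induction step of the recursion: a harmonic vector killed by b stays
harmonic after multiplication by z, as b then produces only the term sigma(1)
g and a sigma(1) g = sigma(0) b g = 0. *)
Lemma harmonic_up g d :
    harmonic a b g -> homogeneous z w a b sg d g -> b g = 0 ->
  [/\ harmonic a b (z g), homogeneous z w a b sg (d + 1) (z g),
      w (b (z g)) = sg (z g) & a (z g) = (d + 1) *: g].
Proof.
move=> hg gg bg.
have wbz : w (b (z g)) = sg (z g).
  by rewrite (dk_bz D) bg linear0 add0r (dk_sgz D).
have azg : a (z g) = (d + 1) *: g.
  rewrite (dk_az D); move: gg; rewrite /homogeneous bg linear0 addr0 => ->.
  by rewrite addrAC addrK scalerDl scale1r.
split=> //.
- by rewrite /harmonic (dk_bz D) bg linear0 add0r -(dk_sgb D) bg linear0.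
- by rewrite /homogeneous azg wbz linearZ.
Qed.

(** On the plane spanned by x and y the operator w b is triangular, with
eigenvalues 0 and d; the vector g spans its kernel. *)
Lemma harmonic_pair x y d t : d != 0 ->
    harmonic a b x -> harmonic b a y ->
    homogeneous z w a b sg d x -> homogeneous w z b a sg d y ->
    w (b x) = t *: y -> z (a y) = t *: x -> sg x = t *: y -> sg y = t *: x ->
  let g := x - d^-1 *: (t *: y) in
  [/\ harmonic a b g, homogeneous z w a b sg d g & b g = 0].
Proof.
move=> d0 hx hy ex ey hwb hza sx sy /=.
have yza : w (b y) = d *: y.
  by apply: (eq_of_sub ey); rewrite hza sy; lmod; ring.
have xwb : z (a x) = d *: x.
  by apply: (eq_of_sub ex); rewrite hwb sx; lmod; ring.
have hyx : harmonic a b y by rewrite /harmonic (dk_ab D).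
have -> : x - d^-1 *: (t *: y) = 1 *: x + (- (d^-1 * t)) *: y by lmod; ring.
have eg : homogeneous z w a b sg d (1 *: x + (- (d^-1 * t)) *: y).
  rewrite /homogeneous !linearD !linearZ /= hwb hza yza xwb sx sy.
  by lmod; ring.
have hg : harmonic a b (1 *: x + (- (d^-1 * t)) *: y).
  by rewrite /harmonic !linearD !linearZ /= hx hyx !scaler0 addr0.
split=> //; apply: (harmonic_lower_eq0 d0 hg) => //.
by rewrite !linearD !linearZ /= hwb yza; lmod; field.
Qed.
End Step.

Section Casimir.
Variables (z w a b sg sp sm E F H Z : {linear V -> V}) (e : K).
Hypotheses (D : dunkl z w a b sg sp sm)
  (EE : forall p, E p = 2^-1 *: z (w p))
  (FE : forall p, F p = - 2 *: a (b p))
  (HE : forall p, H p = z (a p) + w (b p) + p - sg p)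
  (ZE : forall p, Z p = w (b p) - z (a p) + e *: sg p).

Lemma sl2_FE p : F (E p) = E (F p) - H p.
Proof.
rewrite !EE !FE !linearZ /= (dk_bazw D) HE.
have n2 : (2 : K) != 0 by rewrite pnatr_eq0.
by lmod; field.
Qed.

Lemma sg_zw p : sg (z (w p)) = z (w (sg p)).
Proof. by rewrite (dk_sgz D) (dk_spw D) (dk_zw D). Qed.

Lemma sl2_HE p : H (E p) = E (H p) + 2 *: E p.
Proof.
rewrite !EE !HE !linearD !linearN !linearZ /= (dk_azw D) (dk_bzw D) sg_zw.
rewrite !linearD /= -!(dk_zw D).
by lmod; field.
Qed.

Lemma sl2_ZE p : Z (E p) = E (Z p).
Proof.
rewrite !EE !ZE !linearD !linearN !linearZ /= (dk_azw D) (dk_bzw D) sg_zw.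
rewrite !linearD /= -!(dk_zw D).
by lmod; ring.
Qed.

Lemma homogeneous_H d p : homogeneous z w a b sg d p -> H p = (d + 1) *: p.
Proof. by rewrite /homogeneous HE => ->; lmod; ring. Qed.
End Casimir.

Section Reflection.
Variables (z w a b r : {linear V -> V}) (q : K) (v : V) (chi N : K).
Hypothesis q0 : q != 0.
Hypotheses (rz : forall p, r (z p) = q *: w (r p))
  (rw : forall p, r (w p) = q^-1 *: z (r p))
  (rb : forall p, r (b p) = q *: a (r p)) (rv : r v = chi *: v).

(** A reflection carries z to a multiple of w and w b to z a, so it carries
the recursion defining [harm] to its mirror image. *)
Lemma refl_harm n :
  r (harm z w b N v n) = (chi * q ^+ n) *: harm w z a N v n.
Proof.
elim: n => [|n IHn] /=; first by rewrite expr0 mulr1.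
rewrite rz [r (_ - _)]linearB [r (_ *: _)]linearZ /= rw rb.
rewrite [z (q *: _)]linearZ /= [q^-1 *: _]scalerA.
rewrite mulVf // scale1r IHn !linearZ /=.
by rewrite !linearD !linearZ !linearN exprS /=; lmod; ring.
Qed.
End Reflection.

Section Harmonics.
Variables (z w a b sg sp sm : {linear V -> V}) (v : V) (N : K) (t : nat -> K).
Hypotheses (D : dunkl z w a b sg sp sm) (av : a v = 0) (bv : b v = 0).
Local Notation x := (harm z w b N v).
Local Notation y := (harm w z a N v).
Hypotheses (sx : forall n, sg (x n) = t n *: y n)
  (sy : forall n, sg (y n) = t n *: x n) (t0 : t 0%N = N)
  (N0 : forall n, (0 < n)%N -> n%:R - N != 0).

Definition gx n := x n - (n%:R - N)^-1 *: w (b (x n)).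
Definition gy n := y n - (n%:R - N)^-1 *: z (a (y n)).

(** The properties of x_n and y_n have to be proved together, because x_(n+1)
is z times a combination of x_n and y_n. *)
Let inv n :=
  [/\ harmonic a b (x n) /\ harmonic b a (y n),
      homogeneous z w a b sg (n%:R - N) (x n) /\
        homogeneous w z b a sg (n%:R - N) (y n)
    & (0 < n)%N -> w (b (x n)) = t n *: y n /\ z (a (y n)) = t n *: x n].

Let inv_g n : inv n ->
  [/\ harmonic a b (gx n), homogeneous z w a b sg (n%:R - N) (gx n)
    & b (gx n) = 0] /\
  [/\ harmonic b a (gy n), homogeneous w z b a sg (n%:R - N) (gy n)
    & a (gy n) = 0].
Proof.
rewrite /gx /gy.
case: n => [|n] [[hx hy] [ex ey] hn].
  by rewrite /= av bv !linear0 !addr0.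
have [//|hwb hza] := hn.
rewrite hwb hza; split.
  exact: (harmonic_pair D (N0 _) _ _ _ _ hwb hza (sx _) (sy _)).
exact: (harmonic_pair (dunkl_swap D) (N0 _) _ _ _ _ hza hwb (sy _) (sx _)).
Qed.

Let harm_inv n : inv n.
Proof.
elim: n => [|n /inv_g[[hx ex bx] [hy ey ay]]].
  split=> //; rewrite /harmonic /homogeneous /= ?av ?bv ?linear0 //.
  have := sx 0; rewrite /= t0 => ->.
  by split; lmod; ring.
have [] := harmonic_up D hx ex bx.
have [] := harmonic_up (dunkl_swap D) hy ey ay.
rewrite /inv /= -/(gx n) -/(gy n) => ? ? h ? ? ? h' ?; rewrite -natr1 addrAC.
by split=> //; rewrite h h' -[w (gy n)]/(y n.+1) -[z (gx n)]/(x n.+1) sx sy.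
Qed.

Lemma harm_harmonic n : a (b (x n)) = 0 /\ a (b (y n)) = 0.
Proof. by have [[hx hy] _ _] := harm_inv n; rewrite (dk_ab D (y n)). Qed.

Lemma harm_degree n :
  homogeneous z w a b sg (n%:R - N) (x n) /\
  homogeneous z w a b sg (n%:R - N) (y n).
Proof.
by have [_ [ex ey] _] := harm_inv n; split=> //; rewrite /homogeneous addrC.
Qed.

Lemma harm_wb n : (0 < n)%N ->
  w (b (x n)) = t n *: y n /\ z (a (y n)) = t n *: x n.
Proof. by have [_ _] := harm_inv n. Qed.

Lemma harm_xS n : x n.+1 = z (gx n). Proof. by []. Qed.
Lemma harm_yS n : y n.+1 = w (gy n). Proof. by []. Qed.

Lemma gx0 : gx 0 = v. Proof. by rewrite /gx /= bv !linear0 addr0. Qed.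
Lemma gy0 : gy 0 = v. Proof. by rewrite /gy /= av !linear0 addr0. Qed.

Lemma gxE n : (0 < n)%N -> gx n = x n - (t n / (n%:R - N)) *: y n.
Proof. by move=> n0; rewrite /gx (harm_wb n0).1 scalerA mulrC. Qed.
Lemma gyE n : (0 < n)%N -> gy n = y n - (t n / (n%:R - N)) *: x n.
Proof. by move=> n0; rewrite /gy (harm_wb n0).2 scalerA mulrC. Qed.

Lemma gx_gy_killed n : b (gx n) = 0 /\ a (gy n) = 0.
Proof. by have [[_ _ ?] [_ _ ?]] := inv_g (harm_inv n). Qed.

(** This is what keeps the vectors from vanishing: x_(n+1) = 0 would force a
relation between x_n and y_n. *)
Lemma harm_lower n :
  a (x n.+1) = (n.+1%:R - N) *: gx n /\ b (y n.+1) = (n.+1%:R - N) *: gy n.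
Proof.
have [[hx ex bx] [hy ey ay]] := inv_g (harm_inv n).
have [_ _ _ h] := harmonic_up D hx ex bx.
have [_ _ _ h'] := harmonic_up (dunkl_swap D) hy ey ay.
by rewrite harm_xS harm_yS h h' -natr1 addrAC.
Qed.

Lemma harm_xE n : (0 < n)%N -> z (a (x n)) = (n%:R - N) *: x n.
Proof.
move=> n0; have [ex _] := harm_degree n.
by apply: (eq_of_sub ex); rewrite (harm_wb n0).1 sx; lmod; ring.
Qed.

Lemma harm_yE n : (0 < n)%N -> w (b (y n)) = (n%:R - N) *: y n.
Proof.
move=> n0; have [_ ey] := harm_degree n.
by apply: (eq_of_sub ey); rewrite (harm_wb n0).2 sy; lmod; ring.
Qed.

Section Eigen.
Variable e : K.
Let zeps p := w (b p) - z (a p) + e *: sg p.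

Lemma zeps_pair n k l : (0 < n)%N ->
  zeps (k *: x n + l *: y n) =
  (- k * (n%:R - N) + l * (e - 1) * t n) *: x n +
  (l * (n%:R - N) + k * (1 + e) * t n) *: y n.
Proof.
move=> n0; rewrite /zeps !linearD !linearZ /= harm_xE // harm_yE // sx sy.
by have [-> ->] := harm_wb n0; lmod; ring.
Qed.

(** The vector is the image of y_n under zeps + l, and zeps^2 = l^2 on the
plane. *)
Lemma zeps_eigen_pos n l : (0 < n)%N ->
  l ^+ 2 = (n%:R - N) ^+ 2 - (1 - e ^+ 2) * t n ^+ 2 ->
  let p := ((e - 1) * t n) *: x n + (l + (n%:R - N)) *: y n in
  zeps p = l *: p.
Proof.
move=> n0 l2 /=; rewrite zeps_pair // scalerDr !scalerA.
have := l2; set d := n%:R - N => l2'.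
congr (_ *: _ + _ *: _); first by ring.
by apply: (eq_of_sub (esym l2')); ring.
Qed.

Lemma zeps_eigen_neg n l : (0 < n)%N ->
  l ^+ 2 = (n%:R - N) ^+ 2 - (1 - e ^+ 2) * t n ^+ 2 ->
  let p := (l + (n%:R - N)) *: x n + (- (1 + e) * t n) *: y n in
  zeps p = - l *: p.
Proof.
move=> n0 l2 /=; rewrite zeps_pair // scalerDr !scalerA.
have := l2; set d := n%:R - N => l2'.
congr (_ *: _ + _ *: _); last by ring.
by apply: (eq_of_sub l2'); ring.
Qed.

End Eigen.

Section Nonzero.
Variables (r : {linear V -> V}) (chi : K).
Hypotheses (rz : forall p, r (z p) = w (r p)) (rw : forall p, r (w p) = z (r p))
  (ra : forall p, r (a p) = b (r p)) (rb : forall p, r (b p) = a (r p))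
  (rv : r v = chi *: v) (chi0 : chi != 0) (v0 : v != 0)
  (Nt : forall n, (0 < n)%N -> (n%:R - N) ^+ 2 != t n ^+ 2).

Lemma refl_harm_pair n : r (x n) = chi *: y n /\ r (y n) = chi *: x n.
Proof.
have h1 p : r (z p) = 1 *: w (r p) by rewrite scale1r.
have h2 p : r (w p) = 1 *: z (r p) by rewrite scale1r.
have h3 p : r (a p) = 1 *: b (r p) by rewrite scale1r.
have h4 p : r (b p) = 1 *: a (r p) by rewrite scale1r.
split.
  rewrite (@refl_harm z w a b r 1 v chi N) ?oner_neq0 ?invr1 ?expr1n ?mulr1 //.
by rewrite (@refl_harm w z b a r 1 v chi N) ?oner_neq0 ?invr1 ?expr1n ?mulr1.
Qed.

(** Applying r to a relation k x + l y = 0 gives k y + l x = 0, hence k^2 =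
l^2; applying Z_0 gives (d k + t l) x = 0. If k were non-zero this would give
d^2 = t^2. *)
Lemma harm_free n k l : (0 < n)%N -> x n != 0 ->
  k *: x n + l *: y n = 0 -> k = 0 /\ l = 0.
Proof.
move=> n0 x0 e1.
(* The reflected relation. *)
have e2 : k *: y n + l *: x n = 0.
  have [rx ry] := refl_harm_pair n.
  have := congr1 r e1; rewrite [in LHS]linearD !linearZ linear0 /= rx ry => e2.
  apply: (scalerI chi0); rewrite scaler0 -[RHS]e2.
  by lmod; ring.
have := zeps_pair 0 k l n0; rewrite e1 !linear0 !addr0.
set d := n%:R - N => e3.
have e4 : (2 * (t n * l + d * k)) *: x n = 0.
  have : (d * k + t n * l) *: x n = (d * l + t n * k) *: y n.
    by apply: (eq_of_sub e3); lmod; ring.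
  have : t n *: (k *: y n + l *: x n) + d *: (k *: x n + l *: y n) = 0.
    by rewrite e1 e2 !scaler0 addr0.
  move=> e5 e6; rewrite -[RHS]e5.
  by apply: (eq_of_sub e6); lmod; ring.
have {}e4 : t n * l + d * k = 0.
  move/eqP: e4; rewrite scaler_eq0 (negbTE x0) orbF mulf_eq0 pnatr_eq0 /=.
  by move/eqP.
have e5 : (k ^+ 2 - l ^+ 2) *: x n = 0.
  have : k *: (k *: x n + l *: y n) = l *: (k *: y n + l *: x n).
    by rewrite e1 e2 !scaler0.
  by move=> e6; apply: (eq_of_sub e6); lmod; ring.
have {}e5 : k ^+ 2 = l ^+ 2.
  by move/eqP: e5; rewrite scaler_eq0 (negbTE x0) orbF subr_eq0 => /eqP.
have k0 : k = 0.
  apply/eqP; apply: contraT => k0; case/eqP: (Nt n0).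
  apply: (mulIf (expf_neq0 2 k0)).
  rewrite [in RHS]e5 -!exprMn -[t n * l](addrK (d * k)) e4.
  by rewrite sub0r sqrrN.
split=> //; apply/eqP; move: e5; rewrite k0 expr0n /= => /esym/eqP.
by rewrite expf_eq0.
Qed.

Lemma harm_neq0 n : x n != 0.
Proof.
elim: n => [|n IHn] //; apply/eqP => x0.
have [] := harm_lower n; rewrite x0 linear0 => /esym/eqP.
rewrite scaler_eq0 (negbTE (N0 (ltn0Sn n))) /= => /eqP g0 _.
case: (posnP n) => n0; first by move: g0 v0; rewrite n0 gx0 => ->; rewrite eqxx.
have : 1 *: x n + (- (t n / (n%:R - N))) *: y n = 0.
  by rewrite -[RHS]g0 gxE //; lmod; ring.
by case/(harm_free n0 IHn) => /eqP; rewrite oner_eq0.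
Qed.

End Nonzero.

End Harmonics.

(** * The span of the orbits of harmonic vectors *)

(** The linear span is encoded as an intersection of subspaces, so that
stability under an operator has only to be tested on the generators. *)
Definition espan (E : V -> V) (x y : nat -> V) : set V := fun p =>
  forall P : set V, linear_subspace P ->
    (forall j n, P (iter j E (x n)) /\ P (iter j E (y n))) -> P p.

Lemma espan_sym E x y p : espan E x y p -> espan E y x p.
Proof. by move=> h P sP hP; apply: h => // j n; have [] := hP j n. Qed.

Lemma espan_subspace E x y : linear_subspace (espan E x y).
Proof.
split=> [P [P0 _] _|k p q hp hq P sP hP]; first exact: P0.
by apply: sP.2; [exact: hp|exact: hq].
Qed.

Section Subspace.
Variable W : set V.
Hypothesis sW : linear_subspace W.
Lemma subspace0 : W 0. Proof. exact: sW.1. Qed.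
Lemma subspaceZ k p : W p -> W (k *: p).
Proof.
by move=> hp; rewrite -[_ *: _]addr0; apply: sW.2 => //; exact: subspace0.
Qed.
Lemma subspaceD p q : W p -> W q -> W (p + q).
Proof. by move=> hp hq; rewrite -[p]scale1r; exact: sW.2. Qed.
Lemma subspaceB p q : W p -> W q -> W (p - q).
Proof. by move=> hp hq; rewrite -scaleN1r addrC; exact: sW.2. Qed.
End Subspace.

Section Espan.
Variables (E : {linear V -> V}) (x y : nat -> V).
Local Notation W := (espan E x y).
Let sW : linear_subspace W := @espan_subspace E x y.

Lemma espan_gen j n : W (iter j E (x n)) /\ W (iter j E (y n)).
Proof. by split=> P _ hP; have [] := hP j n. Qed.

Lemma espan_x n : W (x n). Proof. exact: (espan_gen 0 n).1. Qed.
Lemma espan_y n : W (y n). Proof. exact: (espan_gen 0 n).2. Qed.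

Lemma espan_stable (O : {linear V -> V}) :
    (forall j n, W (O (iter j E (x n))) /\ W (O (iter j E (y n)))) ->
  forall p, W p -> W (O p).
Proof.
move=> h p hp; apply: (hp (fun q => W (O q))) => //.
split=> [|k q q' hq hq']; first by rewrite linear0; exact: (subspace0 sW).
by rewrite linearP; exact: sW.2.
Qed.

Lemma espan_E p : W p -> W (E p).
Proof. by apply: espan_stable => j n; exact: (espan_gen j.+1 n). Qed.

Lemma espan_iter j p : W p -> W (iter j E p).
Proof. by move=> hp; elim: j => [//|j IHj]; exact: espan_E. Qed.

Lemma iter_comm (O : V -> V) j p :
  (forall q, O (E q) = E (O q)) -> O (iter j E p) = iter j E (O p).
Proof. by move=> h; elim: j => [//|j IHj] /=; rewrite h IHj. Qed.

Lemma espan_comm (O : {linear V -> V}) :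
    (forall p, O (E p) = E (O p)) ->
    (forall n, W (O (x n)) /\ W (O (y n))) ->
  forall p, W p -> W (O p).
Proof.
move=> OE h; apply: espan_stable => j n; have [hx hy] := h n.
by rewrite !iter_comm //; split; exact: espan_iter.
Qed.
End Espan.

Section EspanHarm.
Variables (z w a b sg sp sm E : {linear V -> V}) (v : V) (N : K) (t : nat -> K).
Hypotheses (D : dunkl z w a b sg sp sm) (av : a v = 0) (bv : b v = 0).
Local Notation x := (harm z w b N v).
Local Notation y := (harm w z a N v).
Hypotheses (sx : forall n, sg (x n) = t n *: y n)
  (sy : forall n, sg (y n) = t n *: x n) (t0 : t 0%N = N)
  (N0 : forall n, (0 < n)%N -> n%:R - N != 0)
  (EE : forall p, E p = 2^-1 *: z (w p)).
Local Notation W := (espan E x y).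
Let sW : linear_subspace W := @espan_subspace E x y.
Local Notation gx := (gx z w b v N).
Local Notation gy := (gy z w a v N).

Lemma espan_gx n : W (gx n) /\ W (gy n).
Proof.
case: (posnP n) => [->|n0].
  by rewrite gx0 // gy0 //; have := @espan_x E x y 0.
rewrite (gxE D av bv sx sy t0 N0 n0) (gyE D av bv sx sy t0 N0 n0).
by split; apply: (subspaceB sW) => //; try (apply: (subspaceZ sW) => //);
  (exact: espan_x || exact: espan_y).
Qed.

(** Modulo multiples of z y_n the vector z x_n is x_(n+1), and z y_n = z w g =
2 E g for a vector g of the preceding degree. *)
Lemma espan_z p : W p -> W (z p).
Proof.
have zy n : (0 < n)%N -> W (z (y n)).
  case: n => // n _; rewrite harm_yS.
  have -> : z (w (gy n)) = 2 *: E (gy n).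
    by rewrite EE scalerA divff ?scale1r ?pnatr_eq0.
  by apply: (subspaceZ sW) => //; apply: espan_E; exact: (espan_gx n).2.
apply: espan_comm => [q|n]; first by rewrite !EE linearZ /= (dk_zw D).
case: (posnP n) => [->|n0].
  have W1 : W (z v) by have := @espan_x E x y 1; rewrite harm_xS gx0.
  by [].
split; last exact: zy.
have -> : z (x n) = x n.+1 + (t n / (n%:R - N)) *: z (y n).
  rewrite harm_xS (gxE D av bv sx sy t0 N0 n0) linearB linearZ /=.
  by rewrite subrK.
apply: (subspaceD sW) => //; first exact: espan_x.
by apply: (subspaceZ sW) => //; exact: zy.
Qed.

Hypothesis W_sm : forall p, W p -> W (sm p).
Hypothesis W_w : forall p, W p -> W (w p).

(** The commutator of a and E is w/2, so only a x_n and a y_n matter: a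
x_(n+1) is a multiple of g_n, and a y_(n+1) = a w g = sigma(-1) g because a g
= 0. *)
Lemma espan_a p : W p -> W (a p).
Proof.
have aE j q : W q -> W (a q) -> W (a (iter j E q)).
  move=> hq haq; elim: j => [//|j IHj] /=.
  rewrite EE linearZ /= (dk_azw D) scalerDr -EE.
  apply: (subspaceD sW) => //; first exact: espan_E.
  by apply: (subspaceZ sW) => //; apply: W_w; exact: espan_iter.
apply: espan_stable => j n; suff [h1 h2] : W (a (x n)) /\ W (a (y n)).
  by split; apply: aE => //; [exact: espan_x|exact: espan_y].
case: n => [|n]; first by rewrite /= av; split; exact: (subspace0 sW).
have [-> _] := harm_lower D av bv sx sy t0 N0 n.
split; first by apply: (subspaceZ sW) => //; exact: (espan_gx n).1.
rewrite harm_yS (dk_aw D).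
have [_ ->] := gx_gy_killed D av bv sx sy t0 N0 n.
by rewrite linear0 add0r; apply: W_sm; exact: (espan_gx n).2.
Qed.
End EspanHarm.

Lemma espan_refl (z w a b r E : {linear V -> V}) (q : K) (v : V) (chi N : K) :
    q != 0 -> (forall p, r (z p) = q *: w (r p)) ->
    (forall p, r (w p) = q^-1 *: z (r p)) ->
    (forall p, r (a p) = q^-1 *: b (r p)) ->
    (forall p, r (b p) = q *: a (r p)) -> r v = chi *: v ->
    (forall p, z (w p) = w (z p)) ->
    (forall p, E p = 2^-1 *: z (w p)) ->
  let W := espan E (harm z w b N v) (harm w z a N v) in
  forall p, W p -> W (r p).
Proof.
move=> q0 rz rw ra rb rv zw EE W.
have sW := @espan_subspace E (harm z w b N v) (harm w z a N v).
apply: espan_comm => [p|n].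
  rewrite !EE linearZ /= rz rw [w (_ *: _)]linearZ /= [q *: _]scalerA.
  rewrite divff // scale1r.
  by rewrite zw.
have q1 : q^-1 != 0 by rewrite invr_eq0.
rewrite (refl_harm _ q0 rz rw rb rv).
rewrite (@refl_harm w z b a r q^-1 v chi N) ?invrK //.
by split; apply: (subspaceZ sW) => //; [exact: espan_y|exact: espan_x].
Qed.

End Dunkl.

(** * Orbits of a raising operator *)

Lemma linear_of (K : pzRingType) (U W : lmodType K) (f : U -> W) :
  linear f -> exists F : {linear U -> W}, F =1 f.
Proof.
move=> lf.
by pose F : {linear U -> W} := HB.pack f (GRing.isLinear.Build K U W *:%R f lf);
  exists F.
Qed.

Section Orbit.
Variables (K : numFieldType) (V : lmodType K) (E F H Z : {linear V -> V}).
Hypotheses (FE : forall p, F (E p) = E (F p) - H p)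
  (HE : forall p, H (E p) = E (H p) + 2 *: E p)
  (ZE : forall p, Z (E p) = E (Z p)).

(** The value at E of the polynomial f, applied to p. Polynomials thus serve
as coordinates on the orbit of p, with E acting as multiplication by 'X. *)
Definition orbit_sum (p : V) (f : {poly K}) : V :=
  \sum_(j < size f) f`_j *: iter j E p.

Lemma orbit_sum_wide p (f : {poly K}) n : (size f <= n)%N ->
  orbit_sum p f = \sum_(j < n) f`_j *: iter j E p.
Proof.
move=> fn; rewrite /orbit_sum.
rewrite (big_ord_widen n (fun j => f`_j *: iter j E p)) //.
rewrite big_mkcond; apply: eq_bigr => j _.
by case: ltnP => // h; rewrite nth_default // scale0r.
Qed.

Lemma orbit_sum_is_linear p : linear (orbit_sum p).
Proof.
move=> k f g; set n := maxn (size f) (size g).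
have fn : (size f <= n)%N by exact: leq_maxl.
have gn : (size g <= n)%N by exact: leq_maxr.
have kn : (size (k *: f + g)%R <= n)%N.
  rewrite (leq_trans (size_polyD _ _)) // geq_max gn andbT.
  exact: leq_trans (size_scale_leq _ _) fn.
rewrite !(@orbit_sum_wide _ _ n) // scaler_sumr -big_split.
by apply: eq_bigr => j _; rewrite coefD coefZ scalerDl scalerA.
Qed.

HB.instance Definition _ p :=
  GRing.isLinear.Build K {poly K} V *:%R (orbit_sum p) (orbit_sum_is_linear p).

Lemma orbit_sumC p k : orbit_sum p k%:P = k *: p.
Proof.
rewrite (@orbit_sum_wide _ _ 1) ?size_polyC_leq1 //.
by rewrite big_ord1 coefC eqxx.
Qed.

Lemma orbit_sumXn p j : orbit_sum p 'X^j = iter j E p.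
Proof.
rewrite (@orbit_sum_wide _ _ j.+1) ?size_polyXn //.
rewrite big_ord_recr /= coefXn eqxx scale1r big1 ?add0r // => i _.
by rewrite coefXn (ltn_eqF (ltn_ord i)) scale0r.
Qed.

Lemma orbit_sumX p (f : {poly K}) : orbit_sum p ('X * f) = E (orbit_sum p f).
Proof.
have -> : 'X * f = \sum_(j < size f) f`_j *: 'X^(j.+1).
  rewrite -{1}[f]coefK poly_def mulr_sumr; apply: eq_bigr => j _.
  by rewrite -scalerAr -exprS.
rewrite !linear_sum; apply: eq_bigr => j _.
by rewrite !linearZ /= orbit_sumXn.
Qed.

Section LowestWeight.
Variables (p : V) (mu la : K).
Hypotheses (Fp : F p = 0) (Hp : H p = mu *: p) (Zp : Z p = la *: p).

Lemma orbit_H j : H (iter j E p) = (mu + 2 * j%:R) *: iter j E p.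
Proof.
elim: j => [|j IHj] /=; first by rewrite mulr0 addr0.
rewrite HE IHj linearZ -scalerDl /=; congr (_ *: _).
by rewrite -natr1; ring.
Qed.

Lemma orbit_F j :
  F (iter j.+1 E p) = - (j.+1%:R * (mu + j%:R)) *: iter j E p.
Proof.
elim: j => [|j IHj].
  by rewrite /= FE Fp linear0 sub0r Hp addr0 mul1r scaleNr.
rewrite [iter j.+2 E p]/= FE -[E (iter j E p)]/(iter j.+1 E p) IHj.
rewrite orbit_H linearZ /= -[E (iter j E p)]/(iter j.+1 E p) -scalerBl.
by congr (_ *: _); rewrite -!natr1; ring.
Qed.

Lemma orbit_Z f : Z (orbit_sum p f) = la *: orbit_sum p f.
Proof.
rewrite linear_sum scaler_sumr; apply: eq_bigr => j _.
rewrite linearZ /= [RHS]scalerA [la * _]mulrC -scalerA; congr (_ *: _).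
by elim: (j : nat) => [//|i IHi] /=; rewrite ZE IHi linearZ.
Qed.

(** The operator H in the coordinates of [orbit_sum]. *)
Definition weight_poly (f : {poly K}) :=
  \poly_(j < size f) ((mu + 2 * j%:R) * f`_j).

Lemma orbit_sumH f : H (orbit_sum p f) = orbit_sum p (weight_poly f).
Proof.
rewrite [RHS](@orbit_sum_wide _ _ (size f)) ?size_poly // linear_sum.
apply: eq_bigr => j _; rewrite linearZ /= orbit_H coef_poly ltn_ord scalerA.
by rewrite mulrC.
Qed.

(** The operator F in the coordinates of [orbit_sum], a differential operator
of order two: it lowers the degree by exactly one when no mu + j vanishes. *)
Definition lower_poly (f : {poly K}) :=
  \poly_(j < (size f).-1) (- (j.+1%:R * (mu + j%:R)) * f`_j.+1).

Lemma orbit_sumF f : F (orbit_sum p f) = orbit_sum p (lower_poly f).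
Proof.
rewrite [RHS](@orbit_sum_wide _ _ (size f).-1) ?size_poly // linear_sum.
case ef: (size f) => [|n]; first by rewrite !big_ord0.
rewrite big_ord_recl /= linearZ /= Fp scaler0 add0r.
apply: eq_bigr => j _; rewrite linearZ /= -[E (iter j E p)]/(iter j.+1 E p).
rewrite orbit_F scalerA /lower_poly coef_poly ef /= ltn_ord mulrC.
by rewrite [nat_of_ord _]/=.
Qed.

Hypothesis muP : forall j : nat, mu + j%:R != 0.

Lemma size_lower_poly (f : {poly K}) : size (lower_poly f) = (size f).-1.
Proof.
rewrite /lower_poly; case ef: (size f) => [|[|n]] /=.
- by apply/eqP; rewrite -leqn0 size_poly.
- by apply/eqP; rewrite -leqn0 size_poly.
rewrite size_poly_eq //= mulf_neq0 ?oppr_eq0 ?mulf_neq0 ?pnatr_eq0 ?muP //.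
rewrite -[n.+1]/(n.+2.-1) -ef -/(lead_coef f) lead_coef_eq0.
by rewrite -size_poly_eq0 ef.
Qed.

(** This yields both the injectivity of the coordinates and the irreducibility
of the orbit. *)
Lemma lower_poly_to_const (f : {poly K}) : f != 0 ->
  exists j, exists2 k, k != 0 & iter j lower_poly f = k%:P.
Proof.
move: {2}(size f) (erefl (size f)) => n.
elim: n f => [|n IHn] f ef f0.
  by rewrite -size_poly_eq0 ef in f0.
case: n IHn ef => [|n] IHn ef.
  by exists 0%N; have /size_poly1P[k k0 ->] := introT eqP ef; exists k.
have [||j [k k0 jk]] := IHn (lower_poly f).
- by rewrite size_lower_poly ef.
- by rewrite -size_poly_eq0 size_lower_poly ef.
by exists j.+1, k; rewrite // iterSr.
Qed.

Hypothesis p0 : p != 0.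

Lemma orbit_sum_inj : injective (orbit_sum p).
Proof.
move=> f g fg; apply/eqP; rewrite -subr_eq0; apply/eqP.
have : orbit_sum p (f - g) = 0 by rewrite linearB /= fg subrr.
move: (f - g) => {fg}h h0; apply/eqP; apply: contraT => /lower_poly_to_const[j].
case=> k k0 jk; have : orbit_sum p (iter j lower_poly h) = 0.
  elim: j {jk} => [//|j IHj] /=.
  by rewrite -orbit_sumF IHj linear0.
rewrite jk orbit_sumC => /eqP.
by rewrite scaler_eq0 (negbTE p0) orbF (negbTE k0).
Qed.

Lemma orbit_ker f : F (orbit_sum p f) = 0 -> exists k, orbit_sum p f = k *: p.
Proof.
rewrite orbit_sumF -(linear0 (orbit_sum p)) => /orbit_sum_inj l0.
have := size_lower_poly f; rewrite l0 size_poly0 => /esym h.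
exists f`_0; rewrite -orbit_sumC -size1_polyC //.
by case: (size f) h => [|[]].
Qed.

End LowestWeight.
End Orbit.

Section Decomposition.
Variables (K : numFieldType) (V : lmodType K) (E F H Z : {linear V -> V}).
Hypotheses (FE : forall p, F (E p) = E (F p) - H p)
  (HE : forall p, H (E p) = E (H p) + 2 *: E p)
  (ZE : forall p, Z (E p) = E (Z p)).
Variables (I : eqType) (p : I -> V) (mu la : I -> K).
Hypotheses (Fp : forall i, F (p i) = 0) (Hp : forall i, H (p i) = mu i *: p i)
  (Zp : forall i, Z (p i) = la i *: p i) (la_inj : injective la)
  (p0 : forall i, p i != 0) (muP : forall i (j : nat), mu i + j%:R != 0).

(** Eigenvectors for distinct eigenvalues are independent; the operator Z - la
k removes one summand and leads to the induction hypothesis. *)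
Lemma eigen_free (r : seq I) (u : I -> V) :
    uniq r -> (forall i, Z (u i) = la i *: u i) -> \sum_(i <- r) u i = 0 ->
  forall i, i \in r -> u i = 0.
Proof.
elim: r u => [//|k r IHr] u /= /andP[kr ur] Zu s0.
have h i : i \in r -> u i = 0.
  move=> ir; have ik : i != k by apply: contraNneq kr => <-.
  have Zu' j : Z ((la j - la k) *: u j) = la j *: ((la j - la k) *: u j).
    by rewrite linearZ /= Zu !scalerA mulrC.
  have s' : \sum_(j <- r) (la j - la k) *: u j = 0.
    have : Z (\sum_(j <- k :: r) u j) - la k *: (\sum_(j <- k :: r) u j) = 0.
      by rewrite s0 linear0 scaler0 subrr.
    rewrite linear_sum scaler_sumr -sumrB big_cons Zu subrr add0r => e.
    by rewrite -[RHS]e; apply: eq_bigr => j _; rewrite Zu scalerBl.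
  have /eqP := IHr _ ur Zu' s' i ir.
  by rewrite scaler_eq0 subr_eq0 (inj_eq la_inj) (negbTE ik) => /eqP.
move=> i; rewrite inE => /orP[/eqP->|/h//].
move: s0; rewrite big_cons big_seq big1 ?addr0 //.
Qed.

(** Finite lists stand for elements of the direct sum of the orbits; the same
index may occur several times, and [component] collects its occurrences. *)
Definition orbits_sum (s : seq (I * {poly K})) : V :=
  \sum_(x <- s) orbit_sum E (p x.1) x.2.

Definition component (s : seq (I * {poly K})) (i : I) : {poly K} :=
  \sum_(x <- s | x.1 == i) x.2.

Lemma sum_component (W : lmodType K) (f : I -> {linear {poly K} -> W})
    (s : seq (I * {poly K})) :
  \sum_(x <- s) f x.1 x.2 = \sum_(i <- undup (map fst s)) f i (component s i).
Proof.
transitivity (\sum_(i <- undup (map fst s)) \sum_(x <- s | x.1 == i) f x.1 x.2).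
  rewrite (exchange_big_dep xpredT) //= big_seq [RHS]big_seq.
  apply: eq_bigr => x xs; rewrite big_mkcond (bigD1_seq x.1) ?undup_uniq //=.
    rewrite eqxx big1 ?addr0 // => i; rewrite eq_sym.
    by case: eqP.
  by rewrite mem_undup map_f.
apply: eq_bigr => i _; rewrite linear_sum.
by apply: eq_bigr => x /eqP->.
Qed.

Lemma orbits_sum_free s i : orbits_sum s = 0 -> component s i = 0.
Proof.
move=> s0; case: (boolP (i \in undup (map fst s))) => [iR|iR]; last first.
  rewrite /component big_seq_cond big1 // => x /andP[xs /eqP xi].
  by move: iR; rewrite mem_undup -xi map_f.
apply: (orbit_sum_inj FE HE (Fp i) (Hp i) (muP i) (p0 i)); rewrite linear0.
have := sum_component (fun i => orbit_sum E (p i)) s.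
rewrite -/(orbits_sum s) s0 => /esym /eigen_free; apply=> //.
  exact: undup_uniq.
by move=> k; exact: (orbit_Z ZE (Zp k)).
Qed.

Lemma orbits_sum_cat s s' : orbits_sum (s ++ s') = orbits_sum s + orbits_sum s'.
Proof. by rewrite /orbits_sum big_cat. Qed.

Lemma orbits_sum_scale k s :
  orbits_sum [seq (x.1, k *: x.2) | x <- s] = k *: orbits_sum s.
Proof.
rewrite /orbits_sum big_map scaler_sumr.
by apply: eq_bigr => x _; rewrite linearZ.
Qed.

Hypothesis span : forall q, exists s, q = orbits_sum s.

(** An eigenvector of Z lies in a single orbit, and in an orbit the kernel of
F is the line of lowest weight vectors. *)
Lemma eigen_ker i q : F q = 0 -> Z q = la i *: q -> exists k, q = k *: p i.
Proof.
move=> Fq Zq; have [s es] := span q.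
suff e : q = orbit_sum E (p i) (component s i).
  have := @orbit_ker _ _ E F H FE HE (p i) (mu i) (Fp i) (Hp i) (muP i) (p0 i) _
    (etrans (congr1 F (esym e)) Fq).
  by rewrite -e.
have s2 := sum_component (fun i => orbit_sum E (p i)) s.
rewrite -/(orbits_sum s) -es in s2.
set r := undup _ in s2.
(* The keys of s with i added when it is missing, so that i is always one. *)
pose r' := i :: rem i r.
have ur : uniq r by exact: undup_uniq.
have : \sum_(j <- r) orbit_sum E (p j) (component s j) =
  \sum_(j <- r') orbit_sum E (p j) (component s j).
  rewrite /r' big_cons; case: (boolP (i \in r)) => ir.
    by rewrite (big_rem i ir).
  have -> : component s i = 0.
    rewrite /component big_seq_cond big1 // => x /andP[xs /eqP xi].
    by move: ir; rewrite mem_undup -xi map_f.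
  by rewrite linear0 add0r rem_id.
rewrite -s2 => s3.
(* Moving q to the side of the summand i leaves eigenvectors with sum zero. *)
pose u j := if j == i then orbit_sum E (p i) (component s i) - q
  else orbit_sum E (p j) (component s j).
have ZO j : Z (orbit_sum E (p j) (component s j)) =
    la j *: orbit_sum E (p j) (component s j) by exact: (orbit_Z ZE (Zp j)).
have ur' : uniq r' by rewrite /= rem_uniq // andbT mem_rem_uniq // inE eqxx.
have : u i = 0.
  apply: (@eigen_free r') => //; last by rewrite inE eqxx.
    move=> j; rewrite /u; case: eqP => [->|_]; last exact: ZO.
    by rewrite linearB /= Zq ZO scalerBr.
  have eu : \sum_(j <- rem i r) u j =
      \sum_(j <- rem i r) orbit_sum E (p j) (component s j).
    rewrite big_seq [RHS]big_seq; apply: eq_bigr => j jr; rewrite /u.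
    by case: eqP => // ji; move: jr; rewrite ji mem_rem_uniq // inE eqxx.
  rewrite /r' big_cons eu {1}/u eqxx addrAC; apply/eqP; rewrite subr_eq0.
  by apply/eqP; rewrite [RHS]s3 /r' big_cons.
by rewrite /u eqxx => /eqP; rewrite subr_eq0 => /eqP.
Qed.

(** A linear map is defined on V by choosing an expression of each vector as a
sum over orbits; [orbits_sum_free] makes the value independent of the choice.
*)
Lemma decomposition_direct :
  is_direct_sum (fun i => orbit_sum E (p i) : {linear {poly K} -> V}).
Proof.
move=> W f.
have [sel selP] := boolp.choice span.
pose G q := \sum_(x <- sel q) f x.1 x.2.
have fE s s' : orbits_sum s = orbits_sum s' ->
    \sum_(x <- s) f x.1 x.2 = \sum_(x <- s') f x.1 x.2.
  move=> e; pose s'' := s ++ [seq (x.1, -1 *: x.2) | x <- s'].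
  have /orbits_sum_free s0 : orbits_sum s'' = 0.
    by rewrite orbits_sum_cat orbits_sum_scale e scaleN1r subrr.
  have : \sum_(x <- s'') f x.1 x.2 = 0.
    rewrite sum_component big1 // => i _.
    by rewrite s0 linear0.
  rewrite big_cat big_map /=.
  under [X in _ + X]eq_bigr do rewrite linearZ /= scaleN1r.
  by rewrite sumrN => /eqP; rewrite subr_eq0 => /eqP.
have G_sum s : G (orbits_sum s) = \sum_(x <- s) f x.1 x.2.
  by apply: fE; rewrite -selP.
have Glin : linear G.
  move=> k q q'; rewrite [in LHS](selP q) [in LHS](selP q').
  rewrite -orbits_sum_scale -orbits_sum_cat G_sum big_cat big_map /=.
  congr (_ + _).
  by rewrite /G scaler_sumr; apply: eq_bigr => x _; rewrite linearZ.
have [G' G'E] := linear_of Glin.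
exists G'; split=> [i t|G'' hG'' q].
  rewrite G'E; have := G_sum [:: (i, t)].
  by rewrite /orbits_sum !big_seq1.
rewrite G'E [in LHS](selP q) linear_sum; apply: eq_bigr => x _.
exact: hG''.
Qed.

End Decomposition.

(** * Lowest weight vectors *)

Section LowestWeightVectors.
Variables (K : numFieldType) (V : lmodType K).
Local Ltac lmod := lmod_with K V.
Variables (z w a b sg sp sm E F H Z r : {linear V -> V}) (v : V).
Variables (N e chi : K) (t : nat -> K) (lam : int -> K).
Hypotheses (D : dunkl z w a b sg sp sm)
  (EE : forall p, E p = 2^-1 *: z (w p))
  (FE : forall p, F p = - 2 *: a (b p))
  (HE : forall p, H p = z (a p) + w (b p) + p - sg p)
  (ZE : forall p, Z p = w (b p) - z (a p) + e *: sg p).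
Hypotheses (rz : forall p, r (z p) = w (r p)) (rw : forall p, r (w p) = z (r p))
  (ra : forall p, r (a p) = b (r p)) (rb : forall p, r (b p) = a (r p)).
Hypotheses (v0 : v != 0) (av : a v = 0) (bv : b v = 0)
  (rv : r v = chi *: v) (chi0 : chi != 0).
Local Notation x := (harm z w b N v).
Local Notation y := (harm w z a N v).
Hypotheses (sx : forall n, sg (x n) = t n *: y n)
  (sy : forall n, sg (y n) = t n *: x n) (t0 : t 0%N = N)
  (N0 : forall n, (0 < n)%N -> n%:R - N != 0)
  (Nt : forall n, (0 < n)%N -> (n%:R - N) ^+ 2 != t n ^+ 2).
Hypotheses (lam0 : lam 0 = e * N)
  (lam2 : forall n, (0 < n)%N ->
    lam (Posz n) ^+ 2 = (n%:R - N) ^+ 2 - (1 - e ^+ 2) * t n ^+ 2)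
  (lamN : forall n, (0 < n)%N -> lam (- Posz n) = - lam (Posz n))
  (lam_neq0 : forall n, (0 < n)%N -> lam (Posz n) != 0)
  (lamD : forall n, (0 < n)%N -> lam (Posz n) + (n%:R - N) != 0).

(** The eigenvectors of Z_0 + e sigma in the plane of degree |k|. Each has the
non-zero number lam n + (n - N) among its two coefficients, so the
independence of x_n and y_n keeps it from vanishing. *)
Definition lwv (k : int) : V :=
  match k with
  | Posz 0 => v
  | Posz n.+1 => ((e - 1) * t n.+1) *: x n.+1 +
      (lam (Posz n.+1) + (n.+1%:R - N)) *: y n.+1
  | Negz n => (lam (Posz n.+1) + (n.+1%:R - N)) *: x n.+1 +
      (- (1 + e) * t n.+1) *: y n.+1
  end.

Let lwv_pair k : exists i j, lwv k = i *: x `|k|%N + j *: y `|k|%N.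
Proof.
case: k => [[|n]|n]; last by do 2 eexists.
  by exists 1, 0; rewrite scale1r scale0r addr0.
by do 2 eexists.
Qed.

Lemma lwv_F k : F (lwv k) = 0.
Proof.
have [i [j ->]] := lwv_pair k; rewrite FE.
have [hx hy] := harm_harmonic D av bv sx sy t0 N0 `|k|%N.
rewrite !linearD !linearZ /= hx hy.
by lmod; ring.
Qed.

Lemma lwv_H k : H (lwv k) = ((`|k|%N)%:R + 1 - N) *: lwv k.
Proof.
have [i [j ->]] := lwv_pair k.
have [hx hy] := harm_degree D av bv sx sy t0 N0 `|k|%N.
rewrite linearD !linearZ /= (homogeneous_H HE hx) (homogeneous_H HE hy).
by lmod; ring.
Qed.

Lemma lwv_Z k : Z (lwv k) = lam k *: lwv k.
Proof.
rewrite ZE; case: k => [[|n]|n].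
- have sv := sx 0; rewrite /= t0 in sv.
  by rewrite /lwv av bv !linear0 sv lam0; lmod; ring.
- exact: (zeps_eigen_pos D av bv sx sy t0 N0 (ltn0Sn n) (lam2 (ltn0Sn n))).
rewrite NegzE lamN //.
exact: (zeps_eigen_neg D av bv sx sy t0 N0 (ltn0Sn n) (lam2 (ltn0Sn n))).
Qed.

Lemma lwv_neq0 k : lwv k != 0.
Proof.
have xn n := harm_neq0 D av bv sx sy t0 N0 rz rw ra rb rv chi0 v0 Nt n.
have fr n i j (n0 : (0 < n)%N) :=
  @harm_free _ _ _ _ _ _ _ _ _ _ _ _ D av bv sx sy t0 N0 _ _ rz rw ra rb rv
    chi0 Nt n i j n0 (xn n).
case: k => [[|n]|n] //; apply/eqP => /(fr _ _ _ (ltn0Sn n)) [h1 h2].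
  by have := lamD (ltn0Sn n); rewrite h2 eqxx.
by have := lamD (ltn0Sn n); rewrite h1 eqxx.
Qed.

(** The matrix expressing p_n and p_(-n) in terms of x_n and y_n has
determinant 2 l (l + d), up to sign, so it can be inverted. *)
Lemma lwv_span : (forall q, espan E x y q) ->
  forall q, exists s : seq (int * {poly K}), q = orbits_sum E lwv s.
Proof.
move=> full q; apply: (full q (fun q => exists s, q = orbits_sum E lwv s)).
  split=> [|k _ _ [s1 ->] [s2 ->]].
    by exists [::]; rewrite /orbits_sum big_nil.
  exists ([seq (u.1, k *: u.2) | u <- s1] ++ s2).
  by rewrite orbits_sum_cat orbits_sum_scale.
move=> j n; pose T k i : V := orbits_sum E lwv [:: (k, i *: 'X^j)].
have TE k i : T k i = i *: iter j E (lwv k).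
  by rewrite /T /orbits_sum big_seq1 linearZ /= orbit_sumXn.
have iterD p q' i i' : iter j E (i *: p + i' *: q') =
    i *: iter j E p + i' *: iter j E q'.
  by elim: j {T TE} => [//|j IHj] /=; rewrite IHj linearD !linearZ.
have pairT p i k i' k' : p = i *: lwv k + i' *: lwv k' ->
    exists s, iter j E p = orbits_sum E lwv s.
  move=> ->; exists ([:: (k, i *: 'X^j)] ++ [:: (k', i' *: 'X^j)]).
  by rewrite iterD orbits_sum_cat -/(T k i) -/(T k' i') !TE.
case: n => [|n].
  by split; apply: (pairT _ 1 0 0 0); rewrite /= scale1r scale0r addr0.
have l0 := lam_neq0 (ltn0Sn n); have ld := lamD (ltn0Sn n).
have l2 := lam2 (ltn0Sn n).
have ep : lwv (Posz n.+1) = ((e - 1) * t n.+1) *: x n.+1 +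
   (lam (Posz n.+1) + (n.+1%:R - N)) *: y n.+1 by [].
have em : lwv (Negz n) = (lam (Posz n.+1) + (n.+1%:R - N)) *: x n.+1 +
   (- (1 + e) * t n.+1) *: y n.+1 by [].
move: (lam _) (x n.+1) (y n.+1) (t n.+1) (n.+1%:R - N) l0 ld l2 ep em.
move=> l X Y tn d l0 ld l2 ep em; pose u := 2 * l * (l + d).
have u0 : u != 0 by rewrite !mulf_neq0 // pnatr_eq0.
have uE : u = (l + d) ^+ 2 + (e ^+ 2 - 1) * tn ^+ 2.
  by apply: (eq_of_sub l2); rewrite /u; ring.
split.
  apply: (pairT _ ((l + d) / u) (Negz n) ((1 + e) * tn / u) (Posz n.+1)).
  rewrite ep em -[LHS]scale1r -(divff u0) {1}uE.
  by lmod; field.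
apply: (pairT _ ((l + d) / u) (Posz n.+1) (- ((e - 1) * tn / u)) (Negz n)).
rewrite ep em -[LHS]scale1r -(divff u0) {1}uE.
by lmod; field.
Qed.

End LowestWeightVectors.

(** * Commuting actions on a sum of orbits *)

Section Lines.
Local Open Scope classical_set_scope.
Variables (K : fieldType) (V : lmodType K) (p : V).
Hypothesis p0 : p <> 0.

Definition line : set V := [set k *: p | k in [set: K]].

Lemma line_inj k l : k *: p = l *: p -> k = l.
Proof.
move=> /eqP; rewrite -subr_eq0 -scalerBl scaler_eq0 subr_eq0.
by case/orP=> /eqP.
Qed.

Lemma line_subspace : linear_subspace line.
Proof.
split; first by exists 0; rewrite ?scale0r.
move=> k _ _ [i _ <-] [j _ <-]; exists (k * i + j) => //.
by rewrite scalerDl scalerA.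
Qed.

Lemma line_simple (W : set V) :
  linear_subspace W -> W `<=` line -> W = [set 0] \/ W = line.
Proof.
move=> [W0 Wl] WL; case: (pselect (exists2 q, W q & q <> 0)) => [[q Wq q0]|h].
  right; apply/seteqP; split=> // _ [j _ <-].
  have [k _ kq] := WL _ Wq; have k0 : k != 0.
    by apply/eqP => k0; apply: q0; rewrite -kq k0 scale0r.
  have := Wl (j / k) q 0 Wq W0.
  by rewrite addr0 -kq scalerA divfK.
left; apply/seteqP; split=> [q Wq|_ ->//]; apply: contrapT => q0.
by apply: h; exists q.
Qed.

Definition line_coord (q : V) : K := xget 0 [set k | q = k *: p].

Lemma line_coordZ k : line_coord (k *: p) = k.
Proof.
rewrite /line_coord; by case: xgetP => [l _ /line_inj//|/(_ k)[]].
Qed.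

(** Tensoring with a line changes nothing once a basis vector of the line is
chosen, so L itself, with the coordinate as pairing, is the tensor product. *)
Lemma line_tensor (L : lmodType K) :
  is_tensor_product line (fun q (l : L) => line_coord q *: l).
Proof.
split.
  split=> [k _ _ l [i _ <-] [j _ <-]|k _ l l' [i _ <-]].
    by rewrite scalerA -scalerDl !line_coordZ scalerDl scalerA.
  by rewrite line_coordZ scalerDr !scalerA mulrC.
move=> T b [b1 b2].
have pL : line p by exists 1; rewrite ?scale1r.
have [f fE] := linear_of (fun k l l' => b2 k p l l' pL).
have b0 l : b 0 l = 0.
  have := b1 1 0 0 l line_subspace.1 line_subspace.1.
  rewrite scaler0 addr0 scale1r => /eqP.
  by rewrite -subr_eq0 opprD addrA subrr sub0r oppr_eq0 => /eqP.
exists f; split=> [_ l [k _ <-]|f' f'E l].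
  rewrite line_coordZ linearZ /= fE.
  by have := b1 k p 0 l pL line_subspace.1; rewrite addr0 b0 addr0.
rewrite fE -(f'E p l pL); congr (f' _).
by rewrite -[p in line_coord p]scale1r line_coordZ scale1r.
Qed.
End Lines.

Section DualPair.
Local Open Scope classical_set_scope.
Variables (K : numFieldType) (X : Type) (rel : expr K X -> expr K X -> Prop).
Local Notation A := (palg rel).
Variables (V : lmodType K) (ac : A -> {linear V -> V}).
Hypotheses (acM : forall h h' q, ac (h * h') q = ac h (ac h' q))
  (acD : forall h h' q, ac (h + h') q = ac h q + ac h' q)
  (acZ : forall k h q, ac (k *: h) q = k *: ac h q).
Variables (e f h c : A).
Let E := ac e.
Let F := ac f.
Let H := ac h.
Let Z := ac c.
Hypotheses (FE : forall q, F (E q) = E (F q) - H q)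
  (HE : forall q, H (E q) = E (H q) + 2 *: E q)
  (ZE : forall q, Z (E q) = E (Z q)).
Variables (I : eqType) (p : I -> V) (mu la : I -> K).
Hypotheses (Fp : forall i, F (p i) = 0) (Hp : forall i, H (p i) = mu i *: p i)
  (Zp : forall i, Z (p i) = la i *: p i) (la_inj : injective la)
  (p0 : forall i, p i != 0) (muP : forall i (j : nat), mu i + j%:R != 0).
Hypothesis span : forall q, exists s, q = orbits_sum E p s.

Let U : set A :=
  lie_generated [set g | [\/ g = e, g = f, g = h | g = c]].
Let iota i : {poly K} -> V := orbit_sum E (p i).

Let U_sub : lie_subalgebra U.
Proof.
split=> [W [W0 _ _] _|k a b Ua Ub W sW SW|a b Ua Ub W sW SW]; first exact: W0.
  by case: (sW) => _ + _; apply; [exact: Ua|exact: Ub].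
by case: (sW) => _ _; apply; [exact: Ua|exact: Ub].
Qed.

Let Ue : U e. Proof. by move=> W _; apply; constructor 1. Qed.
Let Uf : U f. Proof. by move=> W _; apply; constructor 2. Qed.
Let Uh : U h. Proof. by move=> W _; apply; constructor 3. Qed.
Let Uc : U c. Proof. by move=> W _; apply; constructor 4. Qed.

Let acB a b q : ac (a - b) q = ac a q - ac b q.
Proof. by rewrite acD -scaleN1r acZ scaleN1r. Qed.

(** The elements that preserve every orbit form a Lie subalgebra, and it
contains the four generators. *)
Lemma orbit_stable u i g : U u -> exists g', iota i g' = ac u (iota i g).
Proof.
move=> Uu.
pose W : set A :=
  [set u | forall g, exists g', iota i g' = ac u (iota i g)].
apply: (Uu W _ _ g) => {u Uu g}; last first.
  move=> u [] -> g.
  - by exists ('X * g); rewrite /iota orbit_sumX.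
  - exists (lower_poly (mu i) g).
    by rewrite /iota (orbit_sumF FE HE (Fp i) (Hp i)).
  - by exists (weight_poly (mu i) g); rewrite /iota (orbit_sumH HE (Hp i)).
  - by exists (la i *: g); rewrite /iota (orbit_Z ZE (Zp i)) linearZ.
split=> [g|k a b Wa Wb g|a b Wa Wb g].
- by exists 0; rewrite /iota linear0 -(scale0r (0 : A)) acZ scale0r.
- have [ga hga] := Wa g; have [gb hgb] := Wb g.
  exists (k *: ga + gb); rewrite acD acZ -hga -hgb /iota.
  by rewrite linearD linearZ.
have [ga hga] := Wa g; have [gb hgb] := Wb g.
have [gab hab] := Wa gb; have [gba hba] := Wb ga.
exists (gab - gba); rewrite acB !acM -hga -hgb -hab -hba /iota.
by rewrite linearB.
Qed.

(** The action of the Lie algebra in the coordinates of the orbit. For u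
outside the Lie algebra the orbit need not be stable, and the value is then 0
by default. *)
Definition lw_rep i (u : A) (g : {poly K}) : {poly K} :=
  xget 0 [set g' | iota i g' = ac u (iota i g)].

Let iota_inj i : injective (iota i).
Proof. exact: (orbit_sum_inj FE HE (Fp i) (Hp i) (muP i) (p0 i)). Qed.

Lemma lw_repP i u g : U u -> iota i (lw_rep i u g) = ac u (iota i g).
Proof.
move=> /(orbit_stable i g)[g' hg']; rewrite /lw_rep.
by case: xgetP => [//|/(_ g')[]].
Qed.

Let iotaD i k g g' : iota i (k *: g + g') = k *: iota i g + iota i g'.
Proof. by rewrite /iota linearD linearZ. Qed.

Let iotaB i g g' : iota i (g - g') = iota i g - iota i g'.
Proof. by rewrite /iota linearB. Qed.

Lemma lw_rep_lie i : lie_representation U (lw_rep i).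
Proof.
case: U_sub => _ UD UL.
split=> [a k g g' Ua|k a b g Ua Ub|a b g Ua Ub]; apply: (@iota_inj i).
- by rewrite iotaD !lw_repP // iotaD linearD linearZ.
- by rewrite iotaD !lw_repP ?acD ?acZ //; exact: UD.
by rewrite iotaB !lw_repP ?acB ?acM //; exact: UL.
Qed.

Lemma lw_rep_f i g : lw_rep i f g = lower_poly (mu i) g.
Proof.
apply: (@iota_inj i); rewrite lw_repP //.
exact: (orbit_sumF FE HE (Fp i) (Hp i)).
Qed.

Lemma lw_rep_e i g : lw_rep i e g = 'X * g.
Proof. by apply: (@iota_inj i); rewrite lw_repP // /iota orbit_sumX. Qed.

(** A non-zero polynomial is lowered to a non-zero constant, and the constants
are raised to all monomials. *)
Lemma lw_rep_irreducible i : irreducible_submodule U (lw_rep i) [set: {poly K}].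
Proof.
split=> [||W [[W0 Wl] Ws] _]; first by split; [split|].
  by exists 1 => //; apply/eqP; exact: oner_neq0.
case: (pselect (exists2 g, W g & g <> 0)) => [[g Wg /eqP g0]|hW].
  right; apply/seteqP; split=> // g' _.
  have [j [k k0 jk]] := lower_poly_to_const (muP i) g0.
  have Wk : W k%:P.
    rewrite -jk; elim: j {jk} => [//|j IHj] /=.
    by rewrite -(lw_rep_f i); exact: Ws.
  have W1 : W 1.
    have := Wl k^-1 _ 0 Wk W0; rewrite addr0 -mul_polyC -polyCM mulVf //.
  have WX n : W 'X^n.
    elim: n => [|n IHn]; first by rewrite expr0.
    by rewrite exprS -(lw_rep_e i); exact: Ws.
  rewrite -[g']coefK poly_def; elim/big_ind: _ => // [q q' hq hq'|n _].
    by have := Wl 1 q q' hq hq'; rewrite scale1r.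
  by have := Wl g'`_n _ 0 (WX n) W0; rewrite addr0.
left; apply/seteqP; split=> [q Wq|_ ->//]; apply: contrapT => q0.
by apply: hW; exists q.
Qed.

Lemma lw_rep_lowest i : exists2 l : {poly K}, l <> 0 &
  [/\ lw_rep i f l = 0, lw_rep i h l = mu i *: l & lw_rep i c l = la i *: l].
Proof.
exists 1; first by apply/eqP; exact: oner_neq0.
have i1 : iota i 1 = p i.
  by rewrite /iota -[1]/(1%:P) orbit_sumC scale1r.
have iZ k : iota i (k *: 1) = k *: p i.
  by rewrite /iota linearZ /= -/(iota i 1) i1.
split; apply: (@iota_inj i); rewrite lw_repP // ?iZ i1 //.
by rewrite /iota linear0; exact: Fp.
Qed.

Let p_neq0 i : p i <> 0. Proof. exact/eqP. Qed.

Lemma lw_eigenspace i :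
  [set q | ac f q = 0 /\ ac c q = la i *: q] = line (p i).
Proof.
apply/seteqP; split=> [q [Fq Zq]|_ [k _ <-]].
  have [k ->] := eigen_ker FE HE ZE Fp Hp Zp la_inj p0 muP span Fq Zq.
  by exists k.
split; first by rewrite linearZ /= -/F Fp scaler0.
by rewrite linearZ /= -/Z Zp scalerA mulrC -scalerA.
Qed.

(** The centraliser commutes with f and c, so it preserves the joint
eigenspace, which [lw_eigenspace] identifies with the line. *)
Lemma centraliser_line i a q : centraliser U a -> line (p i) q ->
  line (p i) (ac a q).
Proof.
move=> ca; rewrite -!lw_eigenspace => -[fq cq]; split.
  by rewrite -acM -ca // acM fq linear0.
by rewrite -acM -ca // acM cq linearZ.
Qed.

Lemma centraliser_irreducible i :
  irreducible_submodule (centraliser U) (fun a q => ac a q) (line (p i)).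
Proof.
split=> [||W [sW _] WL]; last exact: line_simple.
  split; first exact: line_subspace.
  by move=> a q ca; exact: centraliser_line.
by exists (p i) => //; exists 1; rewrite ?scale1r.
Qed.

Let tau i q (g : {poly K}) : {poly K} := line_coord (p i) q *: g.

Lemma centraliser_tau i a q g : centraliser U a -> line (p i) q ->
  iota i (tau i (ac a q) g) = ac a (iota i (tau i q g)).
Proof.
move=> ca [k _ <-]; rewrite /tau.
have [l _ hl] : line (p i) (ac a (p i)).
  by apply: centraliser_line => //; exists 1; rewrite ?scale1r.
have iZ k' g' : iota i (k' *: g') = k' *: iota i g' by rewrite /iota linearZ.
rewrite linearZ /= -hl scalerA !line_coordZ // !iZ linearZ /= -scalerA.
congr (_ *: _); rewrite /iota /orbit_sum [RHS]linear_sum scaler_sumr.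
apply: eq_bigr => j _; rewrite [RHS]linearZ /= [LHS]scalerA mulrC -scalerA.
congr (_ *: _); rewrite (@iter_comm _ _ E (ac a)) -?hl; last first.
  by move=> q'; rewrite /E -!acM ca.
by elim: (nat_of_ord j) => [//|j' IHj] /=; rewrite -IHj linearZ.
Qed.

Lemma lie_tau i u q g : U u ->
  iota i (tau i q (lw_rep i u g)) = ac u (iota i (tau i q g)).
Proof.
move=> Uu; rewrite /tau.
have iZ k' g' : iota i (k' *: g') = k' *: iota i g' by rewrite /iota linearZ.
by rewrite !iZ linearZ /= lw_repP.
Qed.

End DualPair.

(** * Relations of the Cherednik algebra *)

Section Cherednik.
Variables (R : realType) (m : nat).
Local Notation C := R[i].
Local Notation im := (imag R).
Local Notation om := (omega R m).

Lemma imag2 : im * im = -1.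
Proof. by rewrite -expr2 sqr_i. Qed.

Definition cis (t : R) : C := (cos t)%:C + im * (sin t)%:C.

Lemma cisD s t : cis (s + t) = cis s * cis t.
Proof.
rewrite /cis cosD sinD rmorphB rmorphD !rmorphM /=.
have e := congr1 (fun k => k * (sin s)%:C * (sin t)%:C) (esym imag2).
by apply: (eq_of_sub e); ring.
Qed.

Lemma cisX t n : cis t ^+ n = cis (n%:R * t).
Proof.
elim: n => [|n IHn]; first by rewrite mul0r /cis cos0 sin0 mulr0 addr0.
by rewrite exprS IHn -cisD -natr1 mulrDl mul1r addrC.
Qed.

Definition cosC j : C := (cos (angle R m j))%:C.
Definition sinC j : C := (sin (angle R m j))%:C.

Lemma cos2sin2C j : cosC j * cosC j + sinC j * sinC j = 1.
Proof.
by rewrite /cosC /sinC -!rmorphM -rmorphD /= -!expr2 cos2Dsin2.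
Qed.

(** The angle of the j-th root is half the argument of omega^j; this is where
the half angles of the roots turn into powers of omega. *)
Lemma omegaX j : om ^+ j = (cosC j + im * sinC j) ^+ 2.
Proof.
have -> : om = cis (2 * pi / m%:R) by rewrite /omega /cis [LHS]complexE.
rewrite -/(cis (angle R m j)) !cisX; congr cis.
by rewrite /angle; ring.
Qed.

Lemma omega_neq0 : om != 0.
Proof.
have -> : om = cis (2 * pi / m%:R) by rewrite /omega /cis [LHS]complexE.
apply/eqP => h; have := cisD (2 * pi / m%:R) (- (2 * pi / m%:R)).
rewrite h mul0r subrr /cis cos0 sin0 mulr0 addr0 => /eqP.
by rewrite oner_eq0.
Qed.

Lemma omegaXV j : om ^- j = (cosC j - im * sinC j) ^+ 2.
Proof.
have o0 : om ^+ j != 0 by rewrite expf_neq0 ?omega_neq0.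
apply: (mulfI o0); rewrite divff // omegaX -exprMn.
rewrite -[LHS](expr1n _ 2); congr (_ ^+ 2).
rewrite -(cos2sin2C j); have := imag2; move: im => i i2.
by apply: (eq_of_sub (congr1 (fun k => k * sinC j * sinC j) i2)); ring.
Qed.

(** The coordinate functions z and its conjugate, and the vectors zeta and its
conjugate, before they are sent to the algebra. *)
Definition zcov : 'rV[C]_2 := delta_mx 0 0 + im *: delta_mx 0 1.
Definition zbcov : 'rV[C]_2 := delta_mx 0 0 - im *: delta_mx 0 1.
Definition zevec : 'cV[C]_2 := 2^-1 *: (delta_mx 0 0 - im *: delta_mx 1 0).
Definition zebvec : 'cV[C]_2 := 2^-1 *: (delta_mx 0 0 + im *: delta_mx 1 0).

Lemma pairingE (f : 'rV[C]_2) (v : 'cV[C]_2) :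
  pairing f v = f 0 0 * v 0 0 + f 0 1 * v 1 0.
Proof.
rewrite /pairing !mxE !big_ord_recl big_ord0 addr0.
by congr (_ + f _ _ * v _ _); apply: val_inj.
Qed.

Lemma val_sreflV j : (1 <= j <= m)%N ->
  val (srefl j : dihedral R m)^-1%g = refl_mx R m j.
Proof.
move=> hj; rewrite -[LHS]/(invmx (val (srefl j))) val_srefl //.
have h := refl_mxK R m j; have [_ u] := mulmx1_unit h.
by rewrite -[LHS]mulr1 -h mulrA [invmx _ * _]mulVmx // mul1r.
Qed.

Lemma refl_mxE j : map_mx (real_complex R) (refl_mx R m j) =
  \matrix_(i, k)
    if i == 0 then
      if k == 0 then 1 - 2 * sinC j * sinC j else 2 * sinC j * cosC j
    else if k == 0 then 2 * sinC j * cosC j else 1 - 2 * cosC j * cosC j.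
Proof.
apply/matrixP => i k; rewrite !mxE !big_ord_recl big_ord0 !mxE /=.
rewrite /sinC /cosC.
have two (l : 'I_2) : l = 0 \/ l = 1.
  by case: l => [[|[|]]] // h; [left|right]; apply: val_inj.
by case: (two i) => ->; case: (two k) => ->;
  rewrite /= !(mulr0, mulr1, subr0, sub0r, addr0, mulrN, mulNr, mulr0n, mulr1n,
    opprK, rmorphB, rmorphN, rmorphM, rmorphD, rmorph1, rmorph_nat) /=; ring.
Qed.

Lemma row2P (f g : 'rV[C]_2) : f 0 0 = g 0 0 -> f 0 1 = g 0 1 -> f = g.
Proof.
move=> h0 h1; apply/rowP => i.
by case: i => [[|[|]]] // h; [move: h0|move: h1]; congr (f _ _ = g _ _);
  apply: val_inj.
Qed.

Lemma col2P (f g : 'cV[C]_2) : f 0 0 = g 0 0 -> f 1 0 = g 1 0 -> f = g.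
Proof.
move=> h0 h1; apply/colP => i.
by case: i => [[|[|]]] // h; [move: h0|move: h1]; congr (f _ _ = g _ _);
  apply: val_inj.
Qed.

Lemma big_ord2 (F : 'I_2 -> C) : \sum_i F i = F 0 + F 1.
Proof.
by rewrite !big_ord_recl big_ord0 addr0; congr (_ + F _); apply: val_inj.
Qed.

(** Proves an identity modulo two known equations, given the cofactors k and
k'; the equations will be cos^2 + sin^2 = 1 and i^2 = - 1. *)
Lemma eq_of_sub2 (W : pzRingType) (k k' l r l' r' x y : W) : l = r -> l' = r' ->
  x - y = k * (l - r) + k' * (l' - r') -> x = y.
Proof.
by move=> -> -> /eqP; rewrite !subrr !mulr0 addr0 subr_eq0 => /eqP.
Qed.

Local Ltac trig j k k' :=
  apply: (@eq_of_sub2 _ k k' _ _ _ _ _ _ (cos2sin2C j) imag2); ring.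

Lemma zevecE : zevec = 2^-1 *: zbcov^T.
Proof. by congr (_ *: _); apply: col2P; rewrite !mxE. Qed.

Lemma zebvecE : zebvec = 2^-1 *: zcov^T.
Proof. by congr (_ *: _); apply: col2P; rewrite !mxE. Qed.

Section Reflections.
Variable j : nat.
Hypothesis hj : (1 <= j <= m)%N.
Local Notation s := (srefl j : dihedral R m).

Local Ltac entries := rewrite !mxE big_ord2 !mxE /=
  ?(mulr0n, mulr1n, mulr0, mulr1, addr0, add0r).

Lemma act_cov_z : act_cov s zcov = om ^+ j *: zbcov.
Proof.
rewrite /act_cov val_sreflV // refl_mxE omegaX; apply: row2P; entries.
  by trig j (-1 : C) (- sinC j ^+ 2).
by trig j (- im) (2 * sinC j * cosC j + im * sinC j ^+ 2).
Qed.

Lemma act_cov_zb : act_cov s zbcov = om ^- j *: zcov.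
Proof.
rewrite /act_cov val_sreflV // refl_mxE omegaXV; apply: row2P; entries.
  by trig j (-1 : C) (- sinC j ^+ 2).
by trig j (1 * im) (2 * sinC j * cosC j - im * sinC j ^+ 2).
Qed.

(** Reflection matrices are symmetric, so the action on vectors is the
transpose of the action on covectors. *)
Lemma act_vec_tr (f : 'rV[C]_2) : act_vec s f^T = (act_cov s f)^T.
Proof.
rewrite /act_vec /act_cov val_sreflV // val_srefl // trmx_mul; congr (_ *m _).
rewrite refl_mxE; apply/matrixP => i k; rewrite !mxE.
by case: (k == 0); case: (i == 0).
Qed.

Lemma act_vec_ze : act_vec s zevec = om ^- j *: zebvec.
Proof.
rewrite zevecE /act_vec -scalemxAr -/(act_vec s zbcov^T) act_vec_tr act_cov_zb.
by rewrite zebvecE linearZ scalerA mulrC -scalerA.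
Qed.

Lemma act_vec_zeb : act_vec s zebvec = om ^+ j *: zevec.
Proof.
rewrite zebvecE /act_vec -scalemxAr -/(act_vec s zcov^T) act_vec_tr act_cov_z.
by rewrite zevecE linearZ scalerA mulrC -scalerA.
Qed.

End Reflections.

Section Algebra.
Variable c : dihedral R m -> C.
Local Notation A := (cherednik c).

Lemma hvec_lin (k : C) v v' : hvec c (k *: v + v') = k *: hvec c v + hvec c v'.
Proof.
by rewrite /hvec /pgen (pcls_rel (rel_vec_lin c k v v')) pclsD pclsZ.
Qed.

Lemma hcov_lin (k : C) f f' : hcov c (k *: f + f') = k *: hcov c f + hcov c f'.
Proof.
by rewrite /hcov /pgen (pcls_rel (rel_cov_lin c k f f')) pclsD pclsZ.
Qed.

HB.instance Definition _ :=
  GRing.isLinear.Build C 'cV[C]_2 (cherednik c) *:%R (hvec c) hvec_lin.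
HB.instance Definition _ :=
  GRing.isLinear.Build C 'rV[C]_2 (cherednik c) *:%R (hcov c) hcov_lin.

Lemma hzE : hz c = hcov c zcov.
Proof. by rewrite linearD linearZ. Qed.
Lemma hzbarE : hzbar c = hcov c zbcov.
Proof. by rewrite linearB linearZ. Qed.
Lemma hzetaE : hzeta c = hvec c zevec.
Proof. by rewrite linearZ linearB linearZ. Qed.
Lemma hzetabarE : hzetabar c = hvec c zebvec.
Proof. by rewrite linearZ linearD linearZ. Qed.

Lemma hgrp_vec g v : hgrp c g * hvec c v = hvec c (act_vec g v) * hgrp c g.
Proof.
by rewrite /hgrp /hvec /pgen -!pclsM; apply: pcls_rel; exact: rel_grp_vec.
Qed.

Lemma hgrp_cov g v : hgrp c g * hcov c v = hcov c (act_cov g v) * hgrp c g.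
Proof.
by rewrite /hgrp /hcov /pgen -!pclsM; apply: pcls_rel; exact: rel_grp_cov.
Qed.

Lemma hvecC v v' : hvec c v * hvec c v' = hvec c v' * hvec c v.
Proof. by rewrite /hvec /pgen -!pclsM; apply: pcls_rel; exact: rel_vecC. Qed.

Lemma hcovC v v' : hcov c v * hcov c v' = hcov c v' * hcov c v.
Proof. by rewrite /hcov /pgen -!pclsM; apply: pcls_rel; exact: rel_covC. Qed.

Lemma hgrpM g h : hgrp c (g * h)%g = hgrp c g * hgrp c h.
Proof. by rewrite /hgrp /pgen -!pclsM; apply: pcls_rel; exact: rel_grpM. Qed.

Lemma hgrp1 : hgrp c 1%g = 1.
Proof.
rewrite /hgrp /pgen (pcls_rel (rel_grp1 c)) pclsC.
by rewrite scale1r.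
Qed.

(** Taking q = omega^k gives sigma(k) also for negative k, and sigma(-1) is
needed for the commutator of zeta with the conjugate of z. *)
Definition sigmaq (q : C) : A :=
  \sum_(1 <= j < m.+1) (c (srefl j) * q ^+ j) *: hgrp c (srefl j).

Lemma sigma0E : sigma c 0 = sigmaq 1.
Proof. by apply: eq_bigr => j _; rewrite mul0n expr0 expr1n. Qed.

Lemma sigmaq_move (q q' : C) (a b : A) :
  (forall j, (1 <= j <= m)%N ->
     hgrp c (srefl j) * a = q ^+ j *: (b * hgrp c (srefl j))) ->
  sigmaq q' * a = b * sigmaq (q' * q).
Proof.
move=> h; rewrite /sigmaq mulr_suml mulr_sumr.
apply: eq_big_nat => j hj; rewrite -palg_scalerAl h //.
by rewrite scalerA -mulrA -exprMn palg_scalerAr.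
Qed.

Lemma srefl_z j : (1 <= j <= m)%N ->
  hgrp c (srefl j) * hz c = om ^+ j *: (hzbar c * hgrp c (srefl j)).
Proof.
move=> hj; rewrite hzE hzbarE hgrp_cov act_cov_z // linearZ.
by rewrite -palg_scalerAl.
Qed.
Lemma srefl_zb j : (1 <= j <= m)%N ->
  hgrp c (srefl j) * hzbar c = om^-1 ^+ j *: (hz c * hgrp c (srefl j)).
Proof.
move=> hj; rewrite hzE hzbarE hgrp_cov act_cov_zb // linearZ exprVn.
by rewrite -palg_scalerAl.
Qed.
Lemma srefl_ze j : (1 <= j <= m)%N ->
  hgrp c (srefl j) * hzeta c = om^-1 ^+ j *: (hzetabar c * hgrp c (srefl j)).
Proof.
move=> hj; rewrite hzetaE hzetabarE hgrp_vec act_vec_ze // linearZ exprVn.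
by rewrite -palg_scalerAl.
Qed.
Lemma srefl_zeb j : (1 <= j <= m)%N ->
  hgrp c (srefl j) * hzetabar c = om ^+ j *: (hzeta c * hgrp c (srefl j)).
Proof.
move=> hj; rewrite hzetaE hzetabarE hgrp_vec act_vec_zeb // linearZ.
by rewrite -palg_scalerAl.
Qed.

Lemma covRoot (f : 'rV[C]_2) j :
  pairing f (root_vecC R m j) = f 0 0 * sinC j - f 0 1 * cosC j.
Proof.
by rewrite pairingE !mxE /= !(mulr1n, mulr0n, mulr1, mulr0, subr0, sub0r)
  rmorphN mulrN.
Qed.

Lemma rootVec (v : 'cV[C]_2) j :
  pairing (root_covC R m j) v = sinC j * v 0 0 - cosC j * v 1 0.
Proof.
by rewrite pairingE !mxE /= !(mulr1n, mulr0n, mulr1, mulr0, subr0, sub0r)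
  rmorphN mulNr.
Qed.

(** The defining commutation relation, when its coefficients form a geometric
progression in j. *)
Lemma hvec_hcov_sum (v : 'cV[C]_2) (f : 'rV[C]_2) (k p q : C) :
    pairing f v = p ->
    (forall j, 2 * (pairing f (root_vecC R m j) * pairing (root_covC R m j) v)
       = k * q ^+ j) ->
  hvec c v * hcov c f = hcov c f * hvec c v + p *: (1 : A) - k *: sigmaq q.
Proof.
move=> hp hk; have := hvec_hcov c v f; rewrite hp => /(canRL (subrK _)) ->.
rewrite addrC [in LHS]addrA; congr (_ - _).
rewrite /sigmaq !scaler_sumr; apply: eq_bigr => j _; rewrite !scalerA.
by congr (_ *: _); rewrite [RHS]mulrCA -hk; ring.
Qed.

Local Ltac trigf j k k' :=
  apply: (@eq_of_sub2 _ k k' _ _ _ _ _ _ (cos2sin2C j) imag2); field.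
Local Ltac pent k := rewrite pairingE !mxE /= ?(mulr1n, mulr0n);
  trigf 0%N (0 : C) k.
Local Ltac rent :=
  move=> j; rewrite covRoot rootVec !mxE /= ?(mulr1n, mulr0n).

Lemma hzeta_z : hzeta c * hz c = hz c * hzeta c + 1 - sigmaq 1.
Proof.
rewrite hzetaE hzE (@hvec_hcov_sum _ _ 1 1 1); first by rewrite !scale1r.
  by pent (- 2^-1 : C).
by rent; rewrite expr1n; trigf j (1 : C) (- cosC j ^+ 2).
Qed.

Lemma hzetabar_zbar :
  hzetabar c * hzbar c = hzbar c * hzetabar c + 1 - sigmaq 1.
Proof.
rewrite hzetabarE hzbarE (@hvec_hcov_sum _ _ 1 1 1); first by rewrite !scale1r.
  by pent (- 2^-1 : C).
by rent; rewrite expr1n; trigf j (1 : C) (- cosC j ^+ 2).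
Qed.

Lemma hzeta_zbar : hzeta c * hzbar c = hzbar c * hzeta c + sigmaq om^-1.
Proof.
rewrite hzetaE hzbarE (@hvec_hcov_sum _ _ (-1) 0 om^-1).
- by rewrite scale0r addr0 scaleN1r opprK.
- by pent (2^-1 : C).
rent; rewrite exprVn omegaXV.
by trigf j (0 : C) (sinC j ^+ 2 + cosC j ^+ 2).
Qed.

Lemma hzetabar_z : hzetabar c * hz c = hz c * hzetabar c + sigmaq om.
Proof.
rewrite hzetabarE hzE (@hvec_hcov_sum _ _ (-1) 0 om).
- by rewrite scale0r addr0 scaleN1r opprK.
- by pent (2^-1 : C).
rent; rewrite omegaX.
by trigf j (0 : C) (sinC j ^+ 2 + cosC j ^+ 2).
Qed.

End Algebra.

Section StandardModule.
Variables (c chi : dihedral R m -> C).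

(** The scalars carry their structure of numeric field, so that the results
over such fields apply without comparing two presentations of the ring of
scalars. *)
Definition stdmod : lmodType (C : numFieldType) := standard c chi.

Lemma std_act_linear h : linear (std_act c chi h : stdmod -> stdmod).
Proof.
move=> k p q; rewrite /std_act cyc_actDr; congr (_ + _).
rewrite -cyc_actZ -[k *: p]/(cyc_act (k *: (1 : cherednik c)) p) cyc_actA.
by rewrite -palg_scalerAr mulr1.
Qed.

HB.instance Definition _ h :=
  GRing.isLinear.Build C stdmod stdmod *:%R
    (std_act c chi h : stdmod -> stdmod) (std_act_linear h).

Definition act h : {linear stdmod -> stdmod} :=
  (std_act c chi h : stdmod -> stdmod).

Lemma actM h h' p : act (h * h') p = act h (act h' p).
Proof. exact/esym/cyc_actA. Qed.

Lemma act1 p : act 1 p = p.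
Proof. exact: cyc_act1. Qed.

Lemma actD h h' p : act (h + h') p = act h p + act h' p.
Proof. exact: cyc_actDl. Qed.

Lemma actZ k h p : act (k *: h) p = k *: act h p.
Proof. exact: cyc_actZ. Qed.

Lemma actB h h' p : act (h - h') p = act h p - act h' p.
Proof. by rewrite actD -scaleN1r actZ scaleN1r. Qed.

Lemma act_sum (F : nat -> cherednik c) p :
  act (\sum_(1 <= j < m.+1) F j) p = \sum_(1 <= j < m.+1) act (F j) p.
Proof. exact: cyc_act_sum. Qed.

Lemma std_dunkl :
  dunkl (act (hz c)) (act (hzbar c)) (act (hzeta c)) (act (hzetabar c))
    (act (sigmaq c 1)) (act (sigmaq c om)) (act (sigmaq c om^-1)).
Proof.
have o0 := omega_neq0.
have oV : om * om^-1 = 1 by rewrite divff.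
have Vo : om^-1 * om = 1 by rewrite mulVf.
have sz q := @sigmaq_move c om q _ _ (srefl_z c).
have szb q := @sigmaq_move c om^-1 q _ _ (srefl_zb c).
have sze q := @sigmaq_move c om^-1 q _ _ (srefl_ze c).
have szeb q := @sigmaq_move c om q _ _ (srefl_zeb c).
have move2 h1 h2 h3 h4 : h1 * h2 = h3 * h4 ->
    forall p, act h1 (act h2 p) = act h3 (act h4 p).
  by move=> e p; rewrite -[LHS]actM e actM.
split.
- by apply: move2; rewrite hzE hzbarE hcovC.
- by apply: move2; rewrite hzetaE hzetabarE hvecC.
- by move=> p; rewrite -[LHS]actM hzeta_z actB actD act1 actM.
- by move=> p; rewrite -[LHS]actM hzetabar_zbar actB actD act1 actM.
- by move=> p; rewrite -[LHS]actM hzeta_zbar actD actM.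
- by move=> p; rewrite -[LHS]actM hzetabar_z actD actM.
- by apply: move2; rewrite sz mul1r.
- by apply: move2; rewrite szb mul1r.
- by apply: move2; rewrite sze mul1r.
- by apply: move2; rewrite szeb mul1r.
- by apply: move2; rewrite sze oV.
- by apply: move2; rewrite szeb Vo.
- by apply: move2; rewrite szb oV.
- by apply: move2; rewrite sz Vo.
Qed.

End StandardModule.
End Cherednik.

(** * The scalars by which the elements sigma(n) act *)

Lemma sum_nat_rev (W : zmodType) (m : nat) (f g : nat -> W) :
    (0 < m)%N -> (forall j, (1 <= j < m)%N -> f (m - j)%N = g j) -> f m = g m ->
  \sum_(1 <= j < m.+1) f j = \sum_(1 <= j < m.+1) g j.
Proof.
move=> m_gt0 fg fgm; rewrite !big_nat_recr // big_nat_rev fgm; congr (_ + _).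
by apply: eq_big_nat => j hj; rewrite add1n subSS fg.
Qed.

Section Characters.
Variables (R : realType) (m : nat) (m_gt0 : (0 < m)%N).
Local Notation C := R[i].
Local Notation om := (omega R m).
Local Notation s := (@srefl R m).

Lemma omega_m : om ^+ m = 1.
Proof.
have m0 : m%:R != 0 :> R by rewrite pnatr_eq0 -lt0n.
rewrite omegaX /cosC /sinC /angle mulfK // cospi sinpi mulr0 addr0.
by rewrite rmorphN1 sqrrN expr1n.
Qed.

Lemma angle_rev j : (j <= m)%N -> angle R m (m - j) = pi - angle R m j.
Proof.
move=> jm; have m0 : m%:R != 0 :> R by rewrite pnatr_eq0 -lt0n.
by rewrite /angle natrB //; field.
Qed.

(** The reflection s_m is diagonal with entries 1 and -1, and conjugation by
it changes the sign of the cosine of the root. *)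
Lemma srefl_rev j : (1 <= j < m)%N -> (s j ^ s m)%g = s (m - j).
Proof.
move=> /andP[j1 jm].
have hm : (1 <= m <= m)%N by rewrite m_gt0 leqnn.
apply: val_inj.
rewrite [LHS]/= -[invmx _]/(val (s m)^-1%g) val_sreflV //.
rewrite -!/(val _) !val_srefl ?hm ?j1 ?(ltnW jm) ?subn_gt0 ?jm ?leq_subr //.
apply: (@map_mx_inj _ _ (real_complex R : {rmorphism R -> C})).
rewrite !map_mxM !refl_mxE.
have -> : cosC R m (m - j) = - cosC R m j.
  rewrite /cosC angle_rev ?(ltnW jm) // cosB cospi sinpi.
  by rewrite mul0r addr0 mulN1r rmorphN.
have -> : sinC R m (m - j) = sinC R m j.
  rewrite /sinC angle_rev ?(ltnW jm) // sinB cospi sinpi mul0r.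
  by rewrite mulN1r opprK add0r.
have m0 : m%:R != 0 :> R by rewrite pnatr_eq0 -lt0n.
have -> : cosC R m m = -1 by rewrite /cosC /angle mulfK // cospi rmorphN1.
have -> : sinC R m m = 0 by rewrite /sinC /angle mulfK // sinpi.
apply/matrixP => i k; rewrite !mxE big_ord2 !mxE !big_ord2 !mxE /=.
by case: (i == 0); case: (k == 0) => /=; ring.
Qed.

Lemma sreflK j : (1 <= j <= m)%N -> (s j * s j)%g = 1%g.
Proof.
move=> hj; apply: val_inj; rewrite /= -!/(val _) !val_srefl //.
exact: refl_mxK.
Qed.

Variable chi : dihedral R m -> C.
Hypothesis chi_char : linear_character chi.

Lemma chi_srefl2 j : (1 <= j <= m)%N -> chi (s j) * chi (s j) = 1.
Proof. by move=> hj; rewrite -chi_char.2 sreflK // chi_char.1. Qed.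

Lemma chi_srefl j : (1 <= j <= m)%N -> chi (s j) = 1 \/ chi (s j) = -1.
Proof.
move/chi_srefl2/eqP; rewrite -expr2 sqrf_eq1 => /orP[]/eqP; by [left|right].
Qed.

Lemma chi_rev j : (1 <= j < m)%N -> chi (s (m - j)) = chi (s j).
Proof.
move=> hj; rewrite -srefl_rev // /conjg /=.
rewrite !chi_char.2 mulrCA -chi_char.2 mulVg chi_char.1 mulr1 //.
Qed.

Variable c : dihedral R m -> C.
Hypothesis c_class : class_function c.
Hypothesis c_real : forall j, (1 <= j <= m)%N -> c (s j) \is Num.real.

Lemma c_rev j : (1 <= j < m)%N -> c (s (m - j)) = c (s j).
Proof.
by move=> hj; rewrite -srefl_rev // c_class //; case/andP: hj => -> /ltnW.
Qed.

Let omegaV_rev n j : (1 <= j < m)%N -> om^-1 ^+ (n * (m - j)) = om ^+ (n * j).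
Proof.
move=> /andP[_ jm]; have o0 := omega_neq0 R m.
rewrite mulnBr exprVn; apply: (mulfI (expf_neq0 (n * m - n * j) o0)).
rewrite divff ?expf_neq0 // -exprD subnK ?leq_mul2l ?(ltnW jm) ?orbT //.
by rewrite mulnC exprM omega_m expr1n.
Qed.

(** The scalars do not change under n -> - n, since conjugation by s_m
exchanges the terms of index j and m - j. Hence sigma acts by the same scalar
on x_n and on y_n, and this scalar is real. *)
Lemma sigma_chiN n :
  \sum_(1 <= j < m.+1) c (s j) * om^-1 ^+ (n * j) * chi (s j) =
  sigma_chi c chi n.
Proof.
apply: (@sum_nat_rev C m (fun j => c (s j) * om^-1 ^+ (n * j) * chi (s j))
  (fun j => c (s j) * om ^+ (n * j) * chi (s j)) m_gt0) => [j hj|].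
  by rewrite (omegaV_rev n hj) (c_rev hj) (chi_rev hj).
by rewrite mulnC !exprM exprVn omega_m invr1 expr1n.
Qed.

Lemma norm_omega : `|om| = 1.
Proof.
have : `|om| ^+ m == 1 by rewrite -normrX omega_m normr1.
by rewrite pexpr_eq1 // => /eqP.
Qed.

Lemma conj_omega : Num.conj om = om^-1.
Proof.
apply: (mulfI (omega_neq0 R m)); rewrite divff ?omega_neq0 //.
by rewrite -normCK norm_omega expr1n.
Qed.

Lemma sigma_chi_real n : sigma_chi c chi n \is Num.real.
Proof.
rewrite CrealE; apply/eqP; rewrite -[RHS]sigma_chiN rmorph_sum.
apply: eq_big_nat => j hj; rewrite !rmorphM rmorphXn /=.
have /CrealP -> := c_real hj; rewrite conj_omega.
by case: (chi_srefl hj) => ->; rewrite ?rmorphN1 ?rmorph1.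
Qed.

Lemma sigma_chi_bound (d : R) n :
  (forall j, (1 <= j <= m)%N -> `|c (s j)| < d%:C) ->
  `|sigma_chi c chi n| <= (m%:R * d)%:C.
Proof.
move=> cd; apply: le_trans (ler_norm_sum _ _ _) _.
have -> : (m%:R * d)%:C = \sum_(1 <= j < m.+1) d%:C.
  by rewrite sumr_const_nat subSS subn0 rmorphM rmorph_nat mulr_natl.
apply: ler_sum_nat => j hj; rewrite !normrM normrX norm_omega expr1n mulr1.
have -> : `|chi (s j)| = 1.
  by case: (chi_srefl hj) => ->; rewrite ?normrN1 ?normr1.
by rewrite mulr1 ltW // cd.
Qed.

End Characters.

(** * Location of the eigenvalues *)

Section Spectrum.
Variable R : realType.
Local Notation C := R[i].

(** For small t the number (d^2 - (1 - e^2) t^2)^(1/2) is close to d, also for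
large e, because the bound on t is relative to 1 + |e|. *)
Lemma sqrt_near (d t e : R) :
  7%:R / 8%:R <= d -> `|t| * (1 + `|e|) <= 8%:R^-1 ->
  let X := d ^+ 2 - (1 - e ^+ 2) * t ^+ 2 in
  [/\ 0 <= X, 0 < Num.sqrt X, `|Num.sqrt X - d| <= 8%:R^-1
    & d ^+ 2 != t ^+ 2].
Proof.
move=> d78 te; have e0 : 0 <= `|e| by [].
have t0 : 0 <= `|t| by [].
have t1 : `|t| <= 8%:R^-1 by nra.
have et1 : `|e * t| <= 8%:R^-1 by rewrite normrM; nra.
move: t1 et1; rewrite !ler_norml => /andP[t1 t2] /andP[u1 u2].
have tt : t ^+ 2 <= 64%:R^-1 by nra.
have uu : (e * t) ^+ 2 <= 64%:R^-1 by nra.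
have t_ge0 : 0 <= t ^+ 2 by exact: sqr_ge0.
have u_ge0 : 0 <= (e * t) ^+ 2 by exact: sqr_ge0.
move=> X.
have XE : X = d ^+ 2 - t ^+ 2 + (e * t) ^+ 2 by rewrite /X; ring.
have dd : 49%:R / 64%:R <= d ^+ 2 by nra.
have X0 : 0 < X by rewrite XE; lra.
have l0 : 0 < Num.sqrt X by rewrite sqrtr_gt0.
have l2 : Num.sqrt X ^+ 2 = X by rewrite sqr_sqrtr // ltW.
move: (Num.sqrt X) l0 l2 => l l0; rewrite XE => l2.
split=> //=; first by rewrite -XE ltW.
  by rewrite ler_norml; apply/andP; split; nra.
by apply/eqP => h; lra.
Qed.

Variables (eps : R) (r : nat -> R).
Hypothesis r_small : forall n, `|r n| * (1 + `|eps|) <= 8%:R^-1.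

Definition real_lambda (k : int) : R :=
  if k == 0 then eps * r 0%N else
  (sgz k)%:~R * Num.sqrt ((`|k|%N%:R - r 0%N) ^+ 2 -
                          (1 - eps ^+ 2) * r `|k|%N ^+ 2).

Lemma r_le n : - 8%:R^-1 <= r n <= 8%:R^-1.
Proof.
rewrite -ler_norml; have := r_small n; have : 0 <= `|eps| by [].
by have : 0 <= `|r n| by []; nra.
Qed.

Lemma degree_ge n : (0 < n)%N -> 7%:R / 8%:R <= n%:R - r 0%N.
Proof.
move=> n0; have /andP[_ h] := r_le 0.
have : 1 <= n%:R :> R by rewrite ler1n.
lra.
Qed.

(** An error of 1/8 comes from the square root and another 1/8 from N. *)
Lemma real_lambda_near k : `|real_lambda k - k%:~R| <= 4%:R^-1.
Proof.
have /andP[h1 h2] := r_le 0.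
rewrite /real_lambda; case: eqP => [->|/eqP k0].
  rewrite subr0 normrM; have := r_small 0; have : 0 <= `|eps| by [].
  by have : 0 <= `|r 0%N| by []; nra.
have n0 : (0 < `|k|)%N by rewrite absz_gt0.
have [_ l0 ln _] := sqrt_near (degree_ge n0) (r_small `|k|).
move: l0 ln; set l := Num.sqrt _ => l0; rewrite ler_norml => /andP[a1 a2].
have kE : k%:~R = (sgz k)%:~R * `|k|%N%:R :> R.
  by rewrite {1}[k]intEsg intrM.
rewrite kE -mulrBr normrM.
have -> : `|(sgz k)%:~R| = 1 :> R.
  by case: (sgzP k) k0 => // _ _; rewrite ?normrN1 ?normr1.
by rewrite mul1r ler_norml; apply/andP; split; lra.
Qed.

Lemma real_lambda_inj : injective real_lambda.
Proof.
move=> k k' e; have := real_lambda_near k; have := real_lambda_near k'.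
rewrite e.
rewrite !ler_norml => /andP[a1 a2] /andP[b1 b2].
apply/eqP; rewrite -subr_eq0 -normr_le0 -ltzD1 add0r.
rewrite -(ltr_int R) intr_norm rmorphB /= ltr_norml.
by apply/andP; split; lra.
Qed.

Lemma sqrtC_real_complex (x : R) : 0 <= x -> sqrtC x%:C = (Num.sqrt x)%:C.
Proof.
move=> x0; rewrite -[in LHS](sqr_sqrtr x0) rmorphXn /= sqrCK //.
by rewrite lecR sqrtr_ge0.
Qed.

End Spectrum.
Section Lambda.
Variables (R : realType) (m : nat) (c chi : dihedral R m -> R[i]) (eps : R).
Variable r : nat -> R.
Hypothesis sr : forall n, sigma_chi c chi n = (r n)%:C.
Hypothesis r_small : forall n, `|r n| * (1 + `|eps|) <= 8%:R^-1.

Lemma lambdaE k : lambda c chi eps k = (real_lambda eps r k)%:C.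
Proof.
rewrite /lambda /real_lambda /Nchi !sr; case: eqP => [_|/eqP k0].
  by rewrite rmorphM.
have n0 : (0 < `|k|)%N by rewrite absz_gt0.
have [X0 _ _ _] := sqrt_near (degree_ge r_small n0) (r_small `|k|).
rewrite [in RHS]rmorphM rmorph_int /= -sqrtC_real_complex //.
congr (_ * sqrtC _).
by rewrite !(rmorphB, rmorphM, rmorphXn, rmorph1, rmorph_nat).
Qed.

Lemma lambda_inj : injective (lambda c chi eps).
Proof.
by move=> k k'; rewrite !lambdaE => -[] /(real_lambda_inj r_small).
Qed.

End Lambda.

(** * The standard module *)

Section Standard.
Variables (R : realType) (m : nat) (m_gt0 : (0 < m)%N).
Local Notation C := R[i].
Local Notation om := (omega R m).
Local Notation s := (@srefl R m).
Variables (c chi : dihedral R m -> C).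
Hypothesis chi_char : linear_character chi.
Local Notation M := (stdmod c chi).
Local Notation "h · p" := (@act R m c chi h p)
  (at level 40, left associativity).
Local Notation v := (std_vec c chi : stdmod c chi).
Local Notation N := (Nchi c chi).
Local Notation x :=
  (harm (act chi (hz c)) (act chi (hzbar c)) (act chi (hzetabar c)) N v).
Local Notation y :=
  (harm (act chi (hzbar c)) (act chi (hz c)) (act chi (hzeta c)) N v).
Local Notation t := (sigma_chi c chi).
Local Notation W := (espan (act chi (Eplus c)) x y).

Lemma vacuum_a : hzeta c · v = 0.
Proof. by rewrite hzetaE; exact: std_act_vec. Qed.
Lemma vacuum_b : hzetabar c · v = 0.
Proof. by rewrite hzetabarE; exact: std_act_vec. Qed.
Lemma vacuum_g g : hgrp c g · v = chi g *: v.
Proof. exact: std_act_grp. Qed.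

Lemma act_Eplus p : Eplus c · p = 2^-1 *: (hz c · (hzbar c · p)).
Proof. by rewrite /Eplus actZ actM. Qed.
Lemma act_Eminus p : Eminus c · p = - 2 *: (hzeta c · (hzetabar c · p)).
Proof. by rewrite /Eminus actZ actM. Qed.
Lemma act_Hop p : Hop c · p =
  hz c · (hzeta c · p) + hzbar c · (hzetabar c · p) + p - sigmaq c 1 · p.
Proof. by rewrite /Hop actB (actD _ 1) (actD (_ * _)) act1 !actM sigma0E. Qed.
Lemma act_Zeps eps p : Zeps c eps · p =
  hzbar c · (hzetabar c · p) - hz c · (hzeta c · p) +
  eps%:C *: (sigmaq c 1 · p).
Proof. by rewrite /Zeps /Z0 actD actB actZ !actM sigma0E. Qed.

Lemma act_srefl j : (1 <= j <= m)%N ->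
  let r := hgrp c (s j) in
  [/\ forall p, r · (hz c · p) = om ^+ j *: (hzbar c · (r · p)),
      forall p, r · (hzbar c · p) = (om ^+ j)^-1 *: (hz c · (r · p)),
      forall p, r · (hzeta c · p) = (om ^+ j)^-1 *: (hzetabar c · (r · p))
    & forall p, r · (hzetabar c · p) = om ^+ j *: (hzeta c · (r · p))].
Proof.
move=> hj; have move_op (h h' a b : cherednik c) k : h * a = k *: (b * h') ->
    forall p, h · (a · p) = k *: (b · (h' · p)).
  by move=> e p; rewrite -actM e actZ actM.
split; apply: move_op.
- exact: srefl_z.
- by rewrite srefl_zb // exprVn.
- by rewrite srefl_ze // exprVn.
- exact: srefl_zeb.
Qed.

Lemma srefl_harm j n : (1 <= j <= m)%N ->
  hgrp c (s j) · x n = (chi (s j) * om ^+ (n * j)) *: y n /\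
  hgrp c (s j) · y n = (chi (s j) * om^-1 ^+ (n * j)) *: x n.
Proof.
move=> hj; have [rz rw ra rb] := act_srefl hj.
have q0 : om ^+ j != 0 by rewrite expf_neq0 ?omega_neq0.
have q1 : (om ^+ j)^-1 != 0 by rewrite invr_eq0.
have rv := vacuum_g (s j).
rewrite mulnC !exprM; split.
  exact: (@refl_harm _ _ (act chi (hz c)) (act chi (hzbar c))
    (act chi (hzeta c)) (act chi (hzetabar c)) (act chi (hgrp c (s j))) _ v
    (chi (s j)) N q0 rz rw rb rv n).
rewrite exprVn.
have rz' p : hgrp c (s j) · (hz c · p) =
  (om ^+ j)^-1^-1 *: (hzbar c · (hgrp c (s j) · p)) by rewrite invrK.
exact: (@refl_harm _ _ (act chi (hzbar c)) (act chi (hz c))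
  (act chi (hzetabar c)) (act chi (hzeta c)) (act chi (hgrp c (s j))) _ v
  (chi (s j)) N q1 rw rz' ra rv n).
Qed.

Hypothesis c_class : class_function c.

(** Each reflection acts by chi(s_j) omega^(n j) from x_n to y_n, and the sum
of these factors against c is t_n. *)
Lemma sigma_harm n :
  sigmaq c 1 · x n = t n *: y n /\ sigmaq c 1 · y n = t n *: x n.
Proof.
rewrite /sigmaq !act_sum -[in X in _ /\ X](sigma_chiN m_gt0 chi_char c_class).
rewrite !scaler_suml; split; apply: eq_big_nat => j hj;
  rewrite actZ expr1n mulr1.
  by rewrite (srefl_harm n hj).1 scalerA mulrA mulrAC.
by rewrite (srefl_harm n hj).2 scalerA mulrA mulrAC.
Qed.

Let D := std_dunkl c chi.

Lemma std_span_refl j p : (1 <= j <= m)%N -> W p -> W (hgrp c (s j) · p).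
Proof.
move=> hj; have [rz rw ra rb] := act_srefl hj.
have q0 : om ^+ j != 0 by rewrite expf_neq0 ?omega_neq0.
exact: (@espan_refl _ _ (act chi (hz c)) (act chi (hzbar c)) (act chi (hzeta c))
    (act chi (hzetabar c)) (act chi (hgrp c (s j))) (act chi (Eplus c))
    (om ^+ j) v
    (chi (s j)) N q0 rz rw ra rb (vacuum_g (s j)) (dk_zw D) act_Eplus).
Qed.

(** By induction on a word for g, multiplying by one reflection at a time. *)
Lemma std_span_grp g p : W p -> W (hgrp c g · p).
Proof.
have /asboolP[u hu] := valP g; elim: u g hu p => [|j u IHu] g /=.
  move=> _ p; rewrite big_nil => g1 hp.
  have -> : g = 1%g by exact: val_inj.
  by rewrite hgrp1 act1.
move=> /andP[hj hu] p; rewrite big_cons => gE hp.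
have -> : g = (s j * (s j * g))%g by rewrite mulgA sreflK // mul1g.
rewrite hgrpM actM; apply: std_span_refl => //; apply: IHu => //.
rewrite /= -!/(val _) val_srefl // gE mulrA refl_mxK mul1r //.
Qed.

Lemma std_span_sigmaq q p : W p -> W (sigmaq c q · p).
Proof.
move=> hp; rewrite /sigmaq act_sum big_seq.
elim/big_ind: _ => [||j]; [exact: (subspace0 (espan_subspace _ _ _))
  |move=> ? ?; exact: (subspaceD (espan_subspace _ _ _))|].
rewrite mem_index_iota => hj; rewrite actZ.
by apply: (subspaceZ (espan_subspace _ _ _)); exact: std_span_refl.
Qed.

Hypothesis N0 : forall n, (0 < n)%N -> n%:R - N != 0.

Let sx n := (sigma_harm n).1.
Let sy n := (sigma_harm n).2.
Let D' := dunkl_swap D.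
Let act_Eplus' p : Eplus c · p = 2^-1 *: (hzbar c · (hz c · p)).
Proof. by rewrite act_Eplus (dk_zw D). Qed.

Lemma std_span_z p : W p -> W (hz c · p).
Proof.
exact: (espan_z D vacuum_a vacuum_b sx sy (erefl N) N0 act_Eplus).
Qed.

Lemma std_span_zb p : W p -> W (hzbar c · p).
Proof.
move=> /espan_sym hp; apply: espan_sym.
exact: (espan_z D' vacuum_b vacuum_a sy sx (erefl N) N0 act_Eplus').
Qed.

Lemma std_span_ze p : W p -> W (hzeta c · p).
Proof.
exact: (espan_a D vacuum_a vacuum_b sx sy (erefl N) N0 act_Eplus
  (@std_span_sigmaq _) std_span_zb).
Qed.

Lemma std_span_zeb p : W p -> W (hzetabar c · p).
Proof.
move=> /espan_sym hp; apply: espan_sym.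
apply: (espan_a D' vacuum_b vacuum_a sy sx (erefl N) N0 act_Eplus') => //.
  by move=> q /espan_sym hq; apply: espan_sym; exact: std_span_sigmaq.
by move=> q /espan_sym hq; apply: espan_sym; exact: std_span_z.
Qed.

Let sW : linear_subspace W := espan_subspace (act chi (Eplus c)) x y.

Lemma hcovE (f : 'rV[C]_2) : hcov c f =
  (2^-1 * (f 0 0 - imag R * f 0 1)) *: hz c +
  (2^-1 * (f 0 0 + imag R * f 0 1)) *: hzbar c.
Proof.
rewrite hzE hzbarE -!linearZ -linearD /=; congr hcov.
apply: row2P; rewrite !mxE /= !(mulr1n, mulr0n); first by field.
by apply: (@eq_of_sub2 _ 0 (f 0 1) 0 0 _ _ _ _ erefl (imag2 R)); field.
Qed.

Lemma hvecE (f : 'cV[C]_2) : hvec c f =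
  (f 0 0 + imag R * f 1 0) *: hzeta c + (f 0 0 - imag R * f 1 0) *: hzetabar c.
Proof.
rewrite hzetaE hzetabarE -!linearZ -linearD /=; congr hvec.
apply: col2P; rewrite !mxE /= !(mulr1n, mulr0n); first by field.
by apply: (@eq_of_sub2 _ 0 (f 1 0) 0 0 _ _ _ _ erefl (imag2 R)); field.
Qed.

(** Elements of the algebra are classes of formal expressions, so stability
follows from that under the generators. *)
Lemma std_span_act h p : W p -> W (h · p).
Proof.
rewrite -[h]reprK -/(pcls _ _); move: (repr h) => {h}e.
elim: e p => [g|k|e1 IH1 e2 IH2|e1 IH1 e2 IH2] p hp.
- case: g => [f|f|g].
  + rewrite -[pcls _ _]/(hvec c f) hvecE actD.
    rewrite (actZ _ (hzeta c)) (actZ _ (hzetabar c)).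
    apply: (subspaceD sW); apply: (subspaceZ sW).
      exact: std_span_ze.
    exact: std_span_zeb.
  + rewrite -[pcls _ _]/(hcov c f) hcovE actD.
    rewrite (actZ _ (hz c)) (actZ _ (hzbar c)).
    apply: (subspaceD sW); apply: (subspaceZ sW).
      exact: std_span_z.
    exact: std_span_zb.
  + exact: std_span_grp.
- by rewrite pclsC actZ act1; exact: (subspaceZ sW).
- by rewrite pclsD actD; apply: (subspaceD sW); [exact: IH1|exact: IH2].
- by rewrite pclsM actM; apply: IH1; exact: IH2.
Qed.

Lemma act_std_vec (p : M) : p = repr p · v.
Proof.
have := @cyc_act_pi _ _ (@cherednik_rel R m c) (std_annihilator chi) (repr p) 1.
by rewrite mulr1 cyc_piK => /esym.
Qed.

Lemma std_span_full p : W p.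
Proof.
rewrite [p]act_std_vec; apply: std_span_act.
exact: (@espan_x _ _ _ x y 0).
Qed.

End Standard.

(** * The decomposition *)

Section Main.
Variables (R : realType) (m : nat) (m_gt0 : (0 < m)%N).
Local Notation C := R[i].
Local Notation s := (@srefl R m).
Variables (eps : R) (c chi : dihedral R m -> C).
Hypothesis chi_char : linear_character chi.
Hypothesis c_class : class_function c.
Local Notation M := (stdmod c chi).
Local Notation "h · p" := (@act R m c chi h p)
  (at level 40, left associativity).
Local Notation v := (std_vec c chi : stdmod c chi).
Local Notation N := (Nchi c chi).
Local Notation t := (sigma_chi c chi).
Local Notation lam := (lambda c chi eps).
Local Notation e := (eps%:C).
Variable r : nat -> R.
Hypothesis sr : forall n, sigma_chi c chi n = (r n)%:C.
Hypothesis r_small : forall n, `|r n| * (1 + `|eps|) <= 8%:R^-1.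
Hypothesis v0 : v != 0.

Lemma shift_real (n : nat) : n%:R - N = (n%:R - r 0%N)%:C.
Proof. by rewrite /Nchi sr rmorphB rmorph_nat. Qed.

Lemma shift_gt0 n : (0 < n)%N -> 0 < n%:R - N.
Proof.
move=> n0; rewrite shift_real ltcR; have := degree_ge r_small n0; lra.
Qed.

Lemma shift_neq0 n : (0 < n)%N -> n%:R - N != 0.
Proof. by move=> n0; rewrite gt_eqF ?shift_gt0. Qed.

Lemma shift_sigma n : (0 < n)%N -> (n%:R - N) ^+ 2 != t n ^+ 2.
Proof.
move=> n0; have [_ _ _ h] := sqrt_near (degree_ge r_small n0) (r_small n).
rewrite shift_real sr -!rmorphXn /=; apply: contra h => /eqP.
by move/(@fmorph_inj _ _ (real_complex R : {rmorphism R -> C})) => ->.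
Qed.

Lemma lam_0 : lam 0 = e * N.
Proof. by rewrite /lambda eqxx. Qed.

Lemma lam_pos n : (0 < n)%N ->
  [/\ lam (Posz n) ^+ 2 = (n%:R - N) ^+ 2 - (1 - e ^+ 2) * t n ^+ 2,
      lam (- Posz n) = - lam (Posz n) & 0 < lam (Posz n)].
Proof.
move=> n0; have [_ l0 _ _] := sqrt_near (degree_ge r_small n0) (r_small n).
have nz : (Posz n == 0) = false by case: n n0 {l0}.
split.
- by rewrite /lambda nz gtr0_sgz // mul1r sqrtCK.
- by rewrite /lambda oppr_eq0 nz abszN sgzN rmorphN mulNr.
rewrite (lambdaE sr r_small) /real_lambda nz ltcR gtr0_sgz //.
by rewrite mul1r.
Qed.

Lemma lam_neq0 n : (0 < n)%N -> lam (Posz n) != 0.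
Proof. by case/lam_pos => _ _ h; rewrite gt_eqF. Qed.

Lemma lamD_neq0 n : (0 < n)%N -> lam (Posz n) + (n%:R - N) != 0.
Proof.
move=> n0; have [_ _ h] := lam_pos n0.
by rewrite gt_eqF // addr_gt0 // shift_gt0.
Qed.

Lemma weight_neq0 (k : int) (j : nat) : (`|k|%N)%:R + 1 - N + j%:R != 0.
Proof.
have -> : (`|k|%N)%:R + 1 - N + j%:R = (`|k|%N + 1 + j)%N%:R - N.
  by rewrite !natrD; ring.
by rewrite shift_neq0 // addn1.
Qed.

Let D := std_dunkl c chi.
Let av := vacuum_a c chi.
Let bv := vacuum_b c chi.
Let sx n := (sigma_harm m_gt0 chi_char c_class n).1.
Let sy n := (sigma_harm m_gt0 chi_char c_class n).2.

Let EE := act_Eplus (c:=c) (chi:=chi).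
Let FE := act_Eminus (c:=c) (chi:=chi).
Let HE := act_Hop (c:=c) (chi:=chi).
Let ZE := @act_Zeps _ _ c chi eps.

Let hm : (1 <= m <= m)%N. Proof. by rewrite m_gt0 leqnn. Qed.

Let rz p : hgrp c (s m) · (hz c · p) = hzbar c · (hgrp c (s m) · p).
Proof.
by have [-> _ _ _] := act_srefl c chi hm; rewrite omega_m // scale1r.
Qed.
Let rw p : hgrp c (s m) · (hzbar c · p) = hz c · (hgrp c (s m) · p).
Proof.
by have [_ -> _ _] := act_srefl c chi hm; rewrite omega_m // invr1 scale1r.
Qed.
Let ra p : hgrp c (s m) · (hzeta c · p) = hzetabar c · (hgrp c (s m) · p).
Proof.
by have [_ _ -> _] := act_srefl c chi hm; rewrite omega_m // invr1 scale1r.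
Qed.
Let rb p : hgrp c (s m) · (hzetabar c · p) = hzeta c · (hgrp c (s m) · p).
Proof.
by have [_ _ _ ->] := act_srefl c chi hm; rewrite omega_m // scale1r.
Qed.
Let rv := vacuum_g c chi (s m).
Let chi0 : chi (s m) != 0.
Proof.
by have [->|->] := chi_srefl chi_char hm; rewrite ?oppr_eq0 oner_eq0.
Qed.

Definition base := @lwv _ _ (act chi (hz c)) (act chi (hzbar c))
  (act chi (hzeta c)) (act chi (hzetabar c)) v N e t lam.

Let base_F k : Eminus c · base k = 0.
Proof. exact: (lwv_F e lam D FE av bv sx sy (erefl N) shift_neq0 k). Qed.

Let base_H k : Hop c · base k = ((`|k|%N)%:R + 1 - N) *: base k.
Proof. exact: (lwv_H e lam D HE av bv sx sy (erefl N) shift_neq0 k). Qed.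

Let base_Z k : Zeps c eps · base k = lam k *: base k.
Proof.
apply: (lwv_Z D ZE av bv sx sy (erefl N) shift_neq0 lam_0).
  by move=> n /lam_pos[].
by move=> n /lam_pos[].
Qed.

Let base_neq0 k : base k != 0.
Proof.
exact: (lwv_neq0 e D rz rw ra rb v0 av bv rv chi0 sx sy (erefl N) shift_neq0
  shift_sigma lamD_neq0).
Qed.

Let base_span q : exists l : seq (int * {poly C}),
  q = orbits_sum (act chi (Eplus c)) base l.
Proof.
apply: (lwv_span _ lam_neq0 lamD_neq0).
  by move=> n /lam_pos[].
exact: (std_span_full m_gt0 chi_char c_class shift_neq0).
Qed.

Let SFE := sl2_FE D EE FE HE.
Let SHE := sl2_HE D EE HE.
Let SZE := sl2_ZE D EE ZE.
Let lam_inj : injective lam := lambda_inj sr r_small.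

Lemma harm_eigenspaceE k : harm_eigenspace c chi eps k = line (base k).
Proof.
rewrite /harm_eigenspace; case: eqP => [->|_]; first by [].
exact: (lw_eigenspace SFE SHE SZE base_F base_H base_Z lam_inj base_neq0
  weight_neq0 base_span k).
Qed.

Let acM h h' p : (h * h') · p = h · (h' · p). Proof. exact: actM. Qed.
Let acD h h' p : (h + h') · p = h · p + h' · p. Proof. exact: actD. Qed.
Let acZ (k : C) h p : (k *: h) · p = k *: (h · p). Proof. exact: actZ. Qed.

Lemma joint_decomposition_base : joint_decomposition c chi eps.
Proof.
exists (fun _ => {poly C}), (fun _ => {poly C}).
exists (fun k => lw_rep (act chi) (Eplus c) base k).
exists (fun k q (g : {poly C}) => line_coord (base k) q *: g).
exists (fun k => orbit_sum (act chi (Eplus c)) (base k)).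
split.
- move=> k; split.
  + exact: (lw_rep_lie acM acD acZ SFE SHE SZE base_F base_H base_Z base_neq0
      weight_neq0).
  + exact: (lw_rep_irreducible acM acD acZ SFE SHE SZE base_F base_H base_Z
      base_neq0 weight_neq0).
  exact: (lw_rep_lowest acM acD acZ SFE SHE SZE base_F base_H base_Z
    base_neq0 weight_neq0).
- by move=> k; rewrite harm_eigenspaceE; apply: line_tensor; exact/eqP.
- exact: (decomposition_direct SFE SHE SZE base_F base_H base_Z lam_inj
    base_neq0 weight_neq0 base_span).
- move=> k u p l Vu; rewrite harm_eigenspaceE => hp.
  exact: (centraliser_tau acM SFE SHE SZE base_F base_H base_Z lam_inj
    base_neq0 weight_neq0 base_span).
move=> k u p l Uu _.
exact: (lie_tau acM acD acZ SFE SHE SZE base_F base_H base_Z).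
Qed.

Lemma harm_eigenspace_line k :
  one_dimensional (harm_eigenspace c chi eps k) /\
  irreducible_submodule (Vcent c eps) (std_act c chi)
    (harm_eigenspace c chi eps k).
Proof.
rewrite harm_eigenspaceE; split; first by exists (base k) => //; exact/eqP.
exact: (centraliser_irreducible acM SFE SHE SZE base_F base_H base_Z lam_inj
    base_neq0 weight_neq0 base_span).
Qed.
End Main.

Theorem corollary4p6 (R : realType) (m : nat) (m_gt0 : (0 < m)%N)
    (eps : R) (chi : dihedral R m -> R[i]) (chi_char : linear_character chi) :
  exists2 delta : R, 0 < delta &
    forall c : dihedral R m -> R[i],
      class_function c ->
      (forall j, (1 <= j <= m)%N -> c (srefl j) \is Num.real) ->
      (forall j, (1 <= j <= m)%N -> `|c (srefl j)| < delta%:C) ->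
      std_irreducible c chi ->
      std_unitarisable c chi ->
      joint_decomposition c chi eps /\
      forall k : int,
        one_dimensional (harm_eigenspace c chi eps k) /\
        irreducible_submodule (Vcent c eps) (std_act c chi)
          (harm_eigenspace c chi eps k).
Proof.
have e0 : 0 < 1 + `|eps| by rewrite ltr_pwDl.
have m0 : 0 < m%:R :> R by rewrite ltr0n.
(* The factor 1 + |eps| bounds eps t_n along with t_n. *)
pose delta := (8%:R * m%:R * (1 + `|eps|))^-1 : R.
have d0 : 0 < delta by rewrite invr_gt0 !mulr_gt0.
exists delta => // c c_class c_real c_small [_ [p _ p0] _] _.
pose r n : R := complex.Re (sigma_chi c chi n).
have sr n : sigma_chi c chi n = (r n)%:C.
  by rewrite RRe_real // (sigma_chi_real m_gt0 chi_char).
have r_small n : `|r n| * (1 + `|eps|) <= 8%:R^-1.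
  have := sigma_chi_bound m_gt0 chi_char n c_small.
  rewrite sr; have -> : `|(r n)%:C| = (`|r n|)%:C :> R[i].
    case: (ger0P (r n)) => r0; first by rewrite ger0_norm // lecR.
    by rewrite ltr0_norm ?ltcR // rmorphN.
  rewrite lecR => h; have -> : 8%:R^-1 = m%:R * delta * (1 + `|eps|).
    rewrite /delta; field; rewrite ?gt_eqF //.
  by rewrite ler_pM2r.
have v0 : (std_vec c chi : stdmod c chi) != 0.
  apply/eqP => v0; apply: p0; rewrite [LHS]act_std_vec.
  by rewrite v0 linear0.
split.
  exact: (joint_decomposition_base m_gt0 chi_char c_class sr r_small v0).
exact: (harm_eigenspace_line m_gt0 chi_char c_class sr r_small v0).
Qed.
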